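(* Let $\lambda$ be a Young diagram. Then the minimal increasing tableau $M_\lambda$ is a unique rectification target for $\mathbb{N}^2$. Furthermore, an increasing tableau $T$ of type A rectifies to $M_\lambda$ if and only if $w(T)=w(M_\lambda)$.
   Context: **Type A.** Let $\Lambda=\mathbb{N}^2$ ($\mathbb{N}=\{1,2,3,\dots\}$), whose elements $[r,c]$ are boxes in row $r$ (rows numbered top to bottom) and column $c$ (columns numbered left to right), with partial order $[r_1,c_1]\le[r_2,c_2]$ iff $r_1\le r_2$ and $c_1\le c_2$. A straight shape is a finite lower order ideal of $\mathbb{N}^2$, i.e. a Young diagram; a skew shape is $\nu/\lambda:=\nu\setminus\lambda$ with $\lambda\subset\nu$ straight shapes. An increasing tableau of type A is a map $T:\nu/\lambda\to\mathbb{Z}$ on a skew shape with $T(\alpha)<T(\beta)$ whenever $\alpha<\beta$. **Slides.** Two boxes are neighbors if one covers the other. For a tableau $Y$ with values in a set $S$ and $s,s'\in S$, $\mathrm{swap}_{s,s'}(Y)$ is the tableau of the same shape sending $\alpha$ to $s'$ if $Y(\alpha)=s$ and $Y(\beta)=s'$ for some neighbor $\beta$ of $\alpha$; to $s$ if $Y(\alpha)=s'$ and $Y(\beta)=s$ for some neighbor $\beta$ of $\alpha$; and to $Y(\alpha)$ otherwise. If $T$ is increasing of shape $\nu/\lambda$ with values in $[a,b]$ and $C$ is a set of maximal boxes of $\lambda$, the forward slide $\mathrm{jdt}_C(T)$ is obtained by adding the boxes of $C$ filled with $\bullet$, applying $\mathrm{swap}_{a,\bullet},\mathrm{swap}_{a+1,\bullet},\dots,\mathrm{swap}_{b,\bullet}$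 in this order, and deleting all boxes containing $\bullet$. The result is an increasing tableau. A rectification of $T$ is any tableau of straight shape obtained from $T$ by a sequence of forward slides; $T$ rectifies to $U$ if $U$ is a rectification of $T$. An increasing tableau $U$ of straight shape is a unique rectification target if, for every increasing tableau $T$ that has $U$ as a rectification, $U$ is the only rectification of $T$. **Minimal tableau.** $M_\lambda$ is the increasing tableau of shape $\lambda$ sending each box $\alpha\in\lambda$ to the maximal cardinality of a totally ordered subset of $\mathbb{N}^2$ with maximal element $\alpha$; thus $M_\lambda([r,c])=r+c-1$. **Hecke permutation.** Let $\Sigma$ be the group of bijections $w:\mathbb{Z}\to\mathbb{Z}$ with $w(x)=x$ for all but finitely many $x$, viewed as a Coxeter group generated by the simple transpositions $s_i=(i,i+1)$, $i\in\mathbb{Z}$, with length function $\ell$. The Hecke product on $\Sigma$ is the associative monoid product determined by $u\cdot s_i=us_i$ if $\ell(us_i)>\ell(u)$ and $u\cdot s_i=u$ otherwise, and $u\cdot v=u\cdot s_{i_1}\cdot s_{i_2}\cdots s_{i_\ell}$ (multiplied left to right) for any reduced expression $v=s_{i_1}\cdots s_{i_\ell}$. For a word $\mathbf{a}=(a_1,\dots,a_k)$ of integers let $w(\mathbf{a})=s_{a_1}\cdot s_{a_2}\cdot\ldots\cdot s_{a_k}$ (Hecke product). The Hecke permutation of an increasing tableau $T$ of type A is $w(T)=w(\mathbf{a})$, where $\mathbf{a}$ is the row word of $T$, obtained by reading the rows of $T$ from left to right, starting with the bottom row. *)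

(* Defs.v *)
From HB Require Import structures.
From mathcomp Require Import all_boot all_order all_algebra finmap.
From mathcomp Require Import boolp classical_sets cardinality.
From Stdlib Require Import Relation_Operators.

Set Implicit Arguments.
Unset Strict Implicit.
Unset Printing Implicit Defensive.

Import Order.TTheory GRing.Theory Num.Theory.

Local Open Scope fset_scope.
Local Open Scope fmap_scope.
Local Open Scope ring_scope.

(* The poset N^2.  Rows and columns are numbered from 0: the pair (i, j)
   stands for the box [i+1, j+1].  The componentwise order is the library's
   product order on nat *p nat. *)
Notation box := (nat *p nat)%type.

Definition below (b : box) : {fset box} :=
  [fset ((i, j) : box) | i in iota 0 b.1.+1, j in iota 0 b.2.+1].

Lemma mem_below (a b : box) : (a \in below b) = (a <= b)%O.
Proof.
case: a b => i j [k l]; rewrite leEprod /=; apply/imfset2P/andP => /=.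
  case=> x xk [y yl [-> ->]].
  move: (xk : x \in iota 0 k.+1) (yl : y \in iota 0 l.+1).
  by rewrite !mem_iota.
case=> ik jl; exists i; first by rewrite -[_ \in _]/(i \in iota 0 k.+1) mem_iota.
by exists j => //; rewrite -[_ \in _]/(j \in iota 0 l.+1) mem_iota.
Qed.

(* The quantification over below b makes the relation boolean; see coversP. *)
Definition covers (b a : box) : bool :=
  (a < b)%O && [forall c : below b, ~~ ((a < val c)%O && (val c < b)%O)].

Lemma coversP (b a : box) :
  reflect ((a < b)%O /\ forall c : box, ~ ((a < c)%O /\ (c < b)%O))
          (covers b a).
Proof.
apply: (iffP andP) => -[ab H]; split=> //.
  move=> c [ac cb]; have cB : c \in below b by rewrite mem_below ltW.
  by have /forallP/(_ [` cB]) := H; rewrite /= ac cb.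
by apply/forallP => c; apply/negP => /andP[ac cb]; exact: (H (val c)).
Qed.

Definition neighbors (a b : box) : bool := covers a b || covers b a.

Definition straight_shape (s : {fset box}) : Prop :=
  forall a b : box, (a <= b)%O -> b \in s -> a \in s.

Definition skew_shape (s : {fset box}) : Prop :=
  exists nu lam : {fset box},
    [/\ straight_shape nu, straight_shape lam, lam `<=` nu & s = nu `\` lam].

Definition maximal_box (s : {fset box}) (a : box) : Prop :=
  a \in s /\ forall b, b \in s -> ~ (a < b)%O.

(* A tableau with values in S is a finite map whose domain is its shape. *)
Definition increasing_tableau (T : {fmap box -> int}) : Prop :=
  skew_shape (domf T) /\
  forall a b : domf T, (val a < val b)%O -> T a < T b.

Definition swap (S : eqType) (s s' : S) (Y : {fmap box -> S}) :
    {fmap box -> S} :=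
  let next_to (a : domf Y) (v : S) :=
    [exists b : domf Y, neighbors (val a) (val b) && (Y b == v)] in
  [fmap a : domf Y =>
     if (Y a == s) && next_to a s' then s'
     else if (Y a == s') && next_to a s then s
     else Y a].

(* Tableaux with dotted boxes take values in option int, with None as the
   dot. *)
Definition dot : option int := None.

(* T.[? a] is Some (T a) on the shape of T and None, i.e. a dot, on the boxes
   of C outside the shape of T. *)
Definition add_dots (C : {fset box}) (T : {fmap box -> int}) :
    {fmap box -> option int} :=
  [fmap a : domf T `|` C => T.[? val a]].

(* The sequence a, a + 1, ..., b, which is empty if b < a. *)
Definition int_range (a b : int) : seq int :=
  if a <= b then [seq a + k%:Z | k <- iota 0 `|b - a|%N.+1] else [::].

(* reducef keeps the boxes with a value of the form Some v and drops Some. *)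
Definition jdt (a b : int) (C : {fset box}) (T : {fmap box -> int}) :
    {fmap box -> int} :=
  reducef (foldl (fun Y s => swap (Some s) dot Y) (add_dots C T)
                 (int_range a b)).

Definition forward_slide (T T' : {fmap box -> int}) : Prop :=
  increasing_tableau T /\
  exists (nu lam C : {fset box}) (a b : int),
    [/\ [/\ straight_shape nu, straight_shape lam, lam `<=` nu
          & domf T = nu `\` lam],
        forall c, c \in C -> maximal_box lam c,
        forall x : domf T, a <= T x <= b
      & T' = jdt a b C T].

Definition rectifies_to (T U : {fmap box -> int}) : Prop :=
  clos_refl_trans _ forward_slide T U /\ straight_shape (domf U).

Definition unique_rectification_target (U : {fmap box -> int}) : Prop :=
  [/\ increasing_tableau U, straight_shape (domf U)
    & forall T, increasing_tableau T -> rectifies_to T U ->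
      forall U', rectifies_to T U' -> U' = U].

Definition totally_ordered (C : {fset box}) : bool :=
  [forall a : C, [forall b : C, (val a >=< val b)%O]].

(* Every subset of N^2 with maximum a is a subset of below a. *)
Definition max_chain (a : box) : nat :=
  \max_(C <- fpowerset (below a) | totally_ordered C && (a \in C)) #|` C|.

Definition minimal_tableau (lam : {fset box}) : {fmap box -> int} :=
  [fmap a : lam => (max_chain (val a))%:Z].

(* The bijections of int that fix all but finitely many integers. *)
Record Sigma := MkSigma {
  sigma_fun :> int -> int;
  sigma_bij : bijective sigma_fun;
  sigma_fin : finite_set [set x | sigma_fun x <> x]%classic }.

Lemma sigma_eq (u v : Sigma) : sigma_fun u =1 sigma_fun v -> u = v.
Proof.
case: u v => [f fb ff] [g gb gf] /= /funext fg.
by case: _ / fg gb gf => gb gf; congr MkSigma; exact: Prop_irrelevance.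
Qed.

Lemma sigma1_bij : bijective (id : int -> int).
Proof. by exists id. Qed.

Lemma sigma1_fin : finite_set [set x : int | id x <> x]%classic.
Proof. by apply: (sub_finite_set _ (finite_set0 int)) => x /=. Qed.

Definition sigma1 : Sigma := MkSigma sigma1_bij sigma1_fin.

Lemma sigmaM_fin (u v : Sigma) : finite_set [set x | (u \o v) x <> x]%classic.
Proof.
have H : finite_set ([set x | v x <> x] `|` [set x | u x <> x])%classic.
  by rewrite finite_setU; split; exact: sigma_fin.
apply: (sub_finite_set _ H) => x /= uvx.
by have [vx|vx] := EM (v x = x); [right; rewrite vx in uvx | left].
Qed.

Definition sigmaM (u v : Sigma) : Sigma :=
  MkSigma (bij_comp (sigma_bij u) (sigma_bij v)) (sigmaM_fin u v).

Definition transposition (i x : int) : int :=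
  if x == i then i + 1 else if x == i + 1 then i else x.

Lemma transposition_bij (i : int) : bijective (transposition i).
Proof.
suff K : involutive (transposition i) by exists (transposition i).
move=> x; rewrite /transposition /=.
have ne : (i + 1 == i) = false by apply/eqP => /(canRL (addKr _)); rewrite addNr.
have [->|xi] := eqVneq x i; first by rewrite ne eqxx.
have [->|xj] := eqVneq x (i + 1); first by rewrite eqxx.
by rewrite (negPf xi) (negPf xj).
Qed.

Lemma transposition_fin (i : int) :
  finite_set [set x | transposition i x <> x]%classic.
Proof.
apply: (sub_finite_set _ (finite_set2 i (i + 1))) => x /=.
rewrite /transposition /=; have [->|xi] := eqVneq x i; first by left.
by have [->|xj] := eqVneq x (i + 1); [right | ].
Qed.

Definition simple (i : int) : Sigma :=
  MkSigma (transposition_bij i) (transposition_fin i).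

Definition word_product (s : seq int) : Sigma :=
  foldr (fun i u => sigmaM (simple i) u) sigma1 s.

(* The Coxeter length: the least length of a word in the simple
   transpositions with product w.  The simple transpositions generate Sigma,
   so the default value 0 of xget is not used. *)
Definition sigma_length (w : Sigma) : nat :=
  xget 0%N [set n | (exists2 s, size s = n & word_product s = w) /\
                    forall s, word_product s = w -> (n <= size s)%N]%classic.

Definition hecke_mul_simple (u : Sigma) (i : int) : Sigma :=
  if (sigma_length u < sigma_length (sigmaM u (simple i)))%N
  then sigmaM u (simple i) else u.

(* The Hecke product of the simple transpositions indexed by s, multiplied
   from left to right, so that every right factor is simple. *)
Definition hecke_word (s : seq int) : Sigma :=
  foldl hecke_mul_simple sigma1 s.

Definition reading_order (a b : box) : bool :=
  (b.1 < a.1)%N || ((a.1 == b.1) && (a.2 <= b.2)%N).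

Definition row_word (T : {fmap box -> int}) : seq int :=
  pmap (fun a => T.[? a]) (sort reading_order (domf T)).

Definition hecke_permutation (T : {fmap box -> int}) : Sigma :=
  hecke_word (row_word T).

(* Main.v *)
Require Import Defs.
From HB Require Import structures.
From mathcomp Require Import all_boot all_order all_algebra finmap.
From mathcomp Require Import boolp classical_sets.
From mathcomp Require Import zify.
From Stdlib Require Import Relation_Operators.

Set Implicit Arguments.
Unset Strict Implicit.
Unset Printing Implicit Defensive.

Import Order.TTheory GRing.Theory Num.Theory.

Local Open Scope fset_scope.
Local Open Scope fmap_scope.
Local Open Scope ring_scope.

(** Right Hecke multiplication by [s_i] sorts the values at [i] and [i + 1] into
    decreasing order, so a word acts on arbitrary functions [int -> int], and
    this action satisfies the 0-Hecke relations.

    A slide preserves the action of the row word because it can be carried out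
    row by row, from the top.  Let [u] be a row after the slide and [l] the
    next row before the slide, so that [u <= l] columnwise.  Where the two rows
    agree on consecutive values [x, ..., y], the relations
    [(x ... y)(x ... y) = (x+1 ... y)(x ... y) = (x ... y)(x ... y-1)]
    allow one to delete from [l] the entry that moved up, or to insert into the
    upper row the entry that came from below.

    A tableau of straight shape with the Hecke permutation of [M_lambda] is
    [M_lambda]: the position of the value 1 in the permutation is one more than
    the length of the initial run [1, 2, ...] of the first row, nothing can
    follow this run because the permutation of [M_lambda] increases from that
    position on, and the run can be cancelled, which leaves the lower rows. *)

(** * The Hecke product as a bubble sort *)

Definition sort_at (f : int -> int) (i : int) : int -> int := fun p =>
  if p == i then Num.max (f i) (f (i + 1))
  else if p == i + 1 then Num.min (f i) (f (i + 1)) else f p.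

Definition sort_word (f : int -> int) (s : seq int) : int -> int :=
  foldl sort_at f s.

Lemma sort_word_cat f s1 s2 :
  sort_word f (s1 ++ s2) = sort_word (sort_word f s1) s2.
Proof. exact: foldl_cat. Qed.

Lemma sort_atI f x : sort_at (sort_at f x) x = sort_at f x.
Proof.
apply/funext => p; rewrite /sort_at.
have [E|px] := eqVneq p x; first by rewrite ?E; repeat case: eqP; lia.
by have [E|px1] := eqVneq p (x + 1); rewrite ?E; repeat case: eqP; lia.
Qed.

Lemma sort_atC f x y :
  x + 2 <= y -> sort_at (sort_at f x) y = sort_at (sort_at f y) x.
Proof.
move=> xy; apply/funext => p; rewrite /sort_at.
have [E|py] := eqVneq p y; first by rewrite ?E; repeat case: eqP; lia.
have [E|py1] := eqVneq p (y + 1); first by rewrite ?E; repeat case: eqP; lia.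
have [E|px] := eqVneq p x; first by rewrite ?E; repeat case: eqP; lia.
by have [E|px1] := eqVneq p (x + 1); rewrite ?E; repeat case: eqP; lia.
Qed.

Lemma sort_at_braid f x :
  sort_at (sort_at (sort_at f x) (x + 1)) x =
  sort_at (sort_at (sort_at f (x + 1)) x) (x + 1).
Proof.
apply/funext => p; rewrite /sort_at !eqxx.
have -> : (x + 1 == x) = false by lia.
have -> : (x == x + 1) = false by lia.
have -> : (x == x + 1 + 1) = false by lia.
have -> : (x + 1 + 1 == x) = false by lia.
have -> : (x + 1 + 1 == x + 1) = false by lia.
by repeat case: eqP; lia.
Qed.

Lemma sort_word_far f x s :
  all (fun y => (y + 2 <= x) || (x + 2 <= y)) s ->
  sort_word (sort_at f x) s = sort_at (sort_word f s) x.
Proof.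
elim: s f => //= y s IH f /andP[/orP[yx|xy] far].
  by rewrite -sort_atC // IH.
by rewrite sort_atC // IH.
Qed.

(* The exchange property: some letter of [s] is the one that inverts the values
   at [i] and [i + 1], and deleting it multiplies the product by [s_i]. *)
Lemma word_product_exchange s i :
  word_product s (i + 1) < word_product s i ->
  exists2 s', (size s' < size s)%N &
    word_product s' = sigmaM (word_product s) (simple i).
Proof.
elim: s => [|a s IH] /=; first by lia.
set v := word_product s in IH *.
have vij : v i <> v (i + 1).
  by move=> /(bij_inj (sigma_bij v)); lia.
case: (ltrP (v (i + 1)) (v i)) => [vlt _|vge tlt].
  have [s' ss' ws'] := IH vlt; exists (a :: s') => //=.
  by apply: sigma_eq => p /=; rewrite ws'.
(* Left multiplication by [s_a] reverses two distinct values only if they are [a] and [a + 1]; then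
   [s_a v s_i = v], so the letter to delete is [a] itself. *)
have [vi vj] : v i = a /\ v (i + 1) = a + 1.
  by move: tlt; rewrite /= /transposition; repeat case: eqP; lia.
exists s => //; apply: sigma_eq => p /=; rewrite -/v {2}/transposition.
have [E|pi] := eqVneq p i.
  by rewrite ?E vj vi /transposition; repeat case: eqP; lia.
have [E|pj] := eqVneq p (i + 1).
  by rewrite ?E vj vi /transposition; repeat case: eqP; lia.
rewrite /transposition.
have [pa|_] := eqVneq (v p) a.
  by move: pi; rewrite -(inj_eq (bij_inj (sigma_bij v))) vi pa eqxx.
have [pa|//] := eqVneq (v p) (a + 1).
by move: pj; rewrite -(inj_eq (bij_inj (sigma_bij v))) vj pa eqxx.
Qed.

(** For a product of a word the set of lengths of expressions is nonempty, so it has a least element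
    and the default of [xget] does not occur. *)
Lemma sigma_lengthP s :
  (exists2 s', size s' = sigma_length (word_product s) &
     word_product s' = word_product s) /\
  forall s', word_product s' = word_product s ->
    (sigma_length (word_product s) <= size s')%N.
Proof.
pose Q n := `[< exists2 s', size s' = n & word_product s' = word_product s >].
have exQ : exists n, Q n by exists (size s); apply/asboolP; exists s.
rewrite /sigma_length; case: xgetP => [n _ []//|noP].
case: (ex_minnP exQ) => n /asboolP Qn minn; case: (noP n); split=> // s' ws'.
by apply: minn; apply/asboolP; exists s'.
Qed.

Lemma sigmaM_simpleK u i : sigmaM (sigmaM u (simple i)) (simple i) = u.
Proof.
apply: sigma_eq => p /=; congr (u _); rewrite /transposition.
by repeat case: eqP; lia.
Qed.

Lemma word_product_rcons s i :
  word_product (rcons s i) = sigmaM (word_product s) (simple i).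
Proof.
elim: s => [|a s IH] /=; first exact: sigma_eq.
by rewrite IH; apply: sigma_eq.
Qed.

(** The exchange property is applied to a shortest word for the permutation. *)
Lemma sigma_length_descent s i :
  word_product s (i + 1) < word_product s i ->
  (sigma_length (sigmaM (word_product s) (simple i))
     < sigma_length (word_product s))%N.
Proof.
have [[s0 <- ws0] _] := sigma_lengthP s; rewrite -ws0.
move=> /word_product_exchange[s' lt_s' <-]; apply: leq_ltn_trans lt_s'.
by have [_] := sigma_lengthP s'; apply.
Qed.

(** At a descent of [u] the length drops and [u] is already sorted there. At an ascent, [u s_i] has
    a descent at [i] and its product with [s_i] is [u], so the length rises. *)
Lemma hecke_mul_simpleE s i :
  sigma_fun (hecke_mul_simple (word_product s) i) =
  sort_at (word_product s) i.
Proof.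
rewrite /hecke_mul_simple; set u := word_product s.
have uij : u i <> u (i + 1) by move=> /(bij_inj (sigma_bij u)); lia.
have [lt_u|le_u] := ltrP (u (i + 1)) (u i).
  rewrite ltnNge ltnW ?sigma_length_descent //=.
  by apply/funext => p; rewrite /sort_at; repeat case: eqP => [->|?]; lia.
have -> : (sigma_length u < sigma_length (sigmaM u (simple i)))%N.
  rewrite -[u in sigma_length u](sigmaM_simpleK u i) /u -word_product_rcons.
  apply: sigma_length_descent; rewrite word_product_rcons /= -/u.
  by rewrite /transposition; repeat case: eqP; lia.
apply/funext => p /=; rewrite /sort_at /transposition.
by repeat case: eqP => [?|?]; lia.
Qed.

Lemma hecke_wordE s : sigma_fun (hecke_word s) = sort_word id s.
Proof.
(* The length lemmas concern ordinary products of words, so the induction also carries such an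
   expression of the Hecke product. *)
suff [] : sigma_fun (hecke_word s) = sort_word id s /\
    exists s', word_product s' = hecke_word s by [].
elim/last_ind: s => [|s i [IH [s' ws']]]; first by split=> //; exists [::].
have E : hecke_word (rcons s i) = hecke_mul_simple (word_product s') i.
  by rewrite ws' /hecke_word foldl_rcons.
split; first by rewrite E hecke_mul_simpleE ws' IH /sort_word foldl_rcons.
rewrite E /hecke_mul_simple; case: ifP => _; last by exists s'.
by exists (rcons s' i); rewrite word_product_rcons.
Qed.

(** * Two consecutive rows *)

Lemma sort_word_cons f x s : sort_word f (x :: s) = sort_word (sort_at f x) s.
Proof. by []. Qed.

Lemma sort_word_rcons f s x :
  sort_word f (rcons s x) = sort_at (sort_word f s) x.
Proof. exact: foldl_rcons. Qed.

Arguments sort_word : simpl never.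

(** A stretch of one row of a tableau: values at most [lo] or at least [hi] stand for boxes outside
    the shape. *)
Definition letters (lo hi : int) (g : nat -> int) (i n : nat) : seq int :=
  [seq v <- [seq g c | c <- iota i n] | lo < v < hi].

Lemma lettersS lo hi g i n : letters lo hi g i n.+1 =
  if lo < g i < hi then g i :: letters lo hi g i.+1 n
  else letters lo hi g i.+1 n.
Proof. by []. Qed.

Lemma letters_cat lo hi g i n m :
  letters lo hi g i (n + m) = letters lo hi g i n ++ letters lo hi g (i + n) m.
Proof. by rewrite /letters iotaD map_cat filter_cat. Qed.

Lemma lettersSr lo hi g i n : letters lo hi g i n.+1 =
  if lo < g (i + n)%N < hi then rcons (letters lo hi g i n) (g (i + n)%N)
  else letters lo hi g i n.
Proof.
rewrite -addn1 letters_cat lettersS /=.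
by case: ifP; rewrite ?cats1 ?cats0.
Qed.

Lemma lettersP lo hi g i n v :
  reflect (exists c, [/\ (i <= c < i + n)%N, v = g c & lo < g c < hi])
          (v \in letters lo hi g i n).
Proof.
rewrite mem_filter; apply: (iffP andP) => [[gv /mapP[c cin Ev]]|].
  by exists c; rewrite mem_iota in cin; rewrite -Ev.
move=> [c [cin -> gc]]; split=> //; apply/mapP; exists c => //.
by rewrite mem_iota.
Qed.

Lemma incr_addn (g : nat -> int) : (forall c, g c < g c.+1) ->
  forall c d, g c + d%:Z <= g (c + d)%N.
Proof.
move=> g_incr c; elim=> [|d IH]; first by rewrite addn0; lia.
by rewrite addnS; have := g_incr (c + d)%N; lia.
Qed.

Lemma incr_leq (g : nat -> int) : (forall c, g c < g c.+1) ->
  forall c d, (c <= d)%N -> g c + (d - c)%:Z <= g d.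
Proof.
by move=> g_incr c d /subnKC {2}<-; apply: incr_addn.
Qed.

Lemma incr_ltn (g : nat -> int) : (forall c, g c < g c.+1) ->
  forall c d, (c < d)%N -> g c < g d.
Proof. by move=> g_incr c d cd; have := incr_leq g_incr (ltnW cd); lia. Qed.

Lemma incr_filter_sorted lo hi (g : nat -> int) (a : pred nat) i n :
  (forall c, g c < g c.+1) ->
  sorted <%O [seq v <- [seq g c | c <- iota i n & a c] | lo < v < hi].
Proof.
move=> g_incr; apply: sorted_filter; first exact: lt_trans.
rewrite sorted_map; apply: sorted_filter.
  by move=> y x z /=; apply: lt_trans.
by apply: sub_sorted (iota_ltn_sorted i n) => c d; apply: incr_ltn.
Qed.

Lemma letters_sorted lo hi g i n : (forall c, g c < g c.+1) ->
  sorted <%O (letters lo hi g i n).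
Proof. by move/(incr_filter_sorted lo hi predT i n); rewrite filter_predT. Qed.

Section TwoRows.

Variables (lo hi : int) (l u : nat -> int).
Hypothesis l_incr : forall c, l c < l c.+1.
Hypothesis u_incr : forall c, u c < u c.+1.
Hypothesis le_ul : forall c, u c <= l c.

Local Notation L := (letters lo hi l).
Local Notation U := (letters lo hi u).

(* Either [l i] commutes with everything up to the copy [u i], or the next entry
   of both rows is [l i + 1] and a braid relation reduces to that entry. *)
Lemma sort_drop_lower f m i Z : lo < l i < hi -> u i = l i ->
  all (fun z => z + 2 <= l i) Z ->
  sort_word f (l i :: L i.+1 m ++ Z ++ U i m.+1) =
  sort_word f (L i.+1 m ++ Z ++ U i m.+1).
Proof.
have far f' j k Z' : lo < l j < hi -> u j = l j ->
    all (fun z => z + 2 <= l j) Z' ->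
    all (fun y => l j + 2 <= y) (L j.+1 k) ->
    sort_word f' (l j :: L j.+1 k ++ Z' ++ U j k.+1) =
    sort_word f' (L j.+1 k ++ Z' ++ U j k.+1).
  move=> lj uj Zle Lge; rewrite lettersS uj lj sort_word_cons.
  have {}Lge : all (fun y : int => (y + 2 <= l j) || (l j + 2 <= y)) (L j.+1 k).
    by apply: sub_all Lge => z ->; rewrite orbT.
  have {}Zle : all (fun y : int => (y + 2 <= l j) || (l j + 2 <= y)) Z'.
    by apply: sub_all Zle => z ->.
  rewrite !(sort_word_cat, sort_word_cons).
  by rewrite -!(sort_word_far _ Zle) -!(sort_word_far _ Lge) sort_atI.
elim: m i f => [|m IH] i f li ui Zle; first exact: far.
case: (boolP ((lo < l i.+1 < hi) && (l i.+1 == l i + 1))); last first.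
  move=> nadj; apply: far => //; apply/allP => y /lettersP[c [ci -> lc]].
  have := incr_leq l_incr (_ : (i.+1 <= c)%N); have := l_incr i.
  by move: nadj; case: (ltnP i c) => [ic /negP nadj li1 /(_ isT)|]; lia.
case/andP=> li1 /eqP El.
have ui1 : u i.+1 = l i.+1 by have := u_incr i; have := le_ul i.+1; lia.
have Lge k : all (fun y => l i + 2 <= y) (L i.+2 k).
  apply/allP => y /lettersP[c [/andP[ci _] -> _]].
  by have := incr_ltn l_incr ci; lia.
have {}Lge f' k : sort_word (sort_at f' (l i)) (L i.+2 k) =
                  sort_at (sort_word f' (L i.+2 k)) (l i).
  by rewrite sort_word_far //; apply: sub_all (Lge k) => y ->; rewrite orbT.
have Zfar f' : sort_word (sort_at f' (l i)) Z = sort_at (sort_word f' Z) (l i).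
  by rewrite sort_word_far //; apply: sub_all Zle => y ->.
have Zle1 : all (fun z => z + 2 <= l i.+1) Z.
  by apply: sub_all Zle => y; lia.
rewrite lettersS li1 [U i _]lettersS ui li.
rewrite !(sort_word_cat, sort_word_cons) -!Zfar -!Lge.
(* With [x = l i], the upper copy of [x] has been moved left to give the prefix [x, x+1, x]. It
   braids to [x+1, x, x+1], whose last letter the induction hypothesis drops. *)
have := IH i.+1 (sort_at (sort_at f (l i.+1)) (l i)) li1 ui1 Zle1.
by rewrite !(sort_word_cat, sort_word_cons) El sort_at_braid.
Qed.

(** Mirror image of [sort_drop_lower]: the last letter [u m] commutes back to its copy [l m], unless
    the entry before it in the upper row is in range and one smaller. Then the lower row agrees
    there too, and a braid relation reduces to the preceding column. *)
Lemma sort_drop_upper f m B : lo < u m < hi -> u m = l m ->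
  all (fun y => u m + 2 <= y) B ->
  sort_word f (L 0 m.+1 ++ B ++ rcons (U 0 m) (u m)) =
  sort_word f (L 0 m.+1 ++ B ++ U 0 m).
Proof.
have far f' k B' : lo < u k < hi -> u k = l k ->
    all (fun y => u k + 2 <= y) B' ->
    all (fun y => y + 2 <= u k) (U 0 k) ->
    sort_word f' (L 0 k.+1 ++ B' ++ rcons (U 0 k) (u k)) =
    sort_word f' (L 0 k.+1 ++ B' ++ U 0 k).
  move=> uk lk Bge Ule; rewrite lettersSr add0n -lk uk.
  rewrite !(sort_word_cat, sort_word_rcons).
  have {}Bge : all (fun y : int => (y + 2 <= u k) || (u k + 2 <= y)) B'.
    by apply: sub_all Bge => z ->; rewrite orbT.
  have {}Ule : all (fun y : int => (y + 2 <= u k) || (u k + 2 <= y)) (U 0 k).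
    by apply: sub_all Ule => z ->.
  by rewrite -(sort_word_far _ Ule) -(sort_word_far _ Bge) sort_atI.
elim: m f B => [|m IH] f B um lm Bge; first exact: far.
case: (boolP ((lo < u m < hi) && (u m == u m.+1 - 1))); last first.
  move=> nadj; apply: far => //; apply/allP => y /lettersP[c [ci -> lc]].
  have := incr_leq u_incr (_ : (c <= m)%N); have := u_incr m.
  by move: nadj; case: (ltnP c m) => [ic /negP nadj li1 /(_ (ltnW ic))|]; lia.
case/andP=> um1 /eqP Eu.
have lm1 : l m = u m by have := l_incr m; have := le_ul m; lia.
have Ule : all (fun y => y + 2 <= u m.+1) (U 0 m).
  apply/allP => y /lettersP[c [/andP[_ ci] -> _]].
  by have := incr_ltn u_incr (ci : (c < m)%N); lia.
have {}Ufar f' : sort_word (sort_at f' (u m.+1)) (U 0 m) =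
                  sort_at (sort_word f' (U 0 m)) (u m.+1).
  by rewrite sort_word_far //; apply: sub_all Ule => y ->.
have Bfar f' : sort_word (sort_at f' (u m.+1)) B =
               sort_at (sort_word f' B) (u m.+1).
  by rewrite sort_word_far //; apply: sub_all Bge => y ->; rewrite orbT.
have Bge1 : all (fun z => u m + 2 <= z) B.
  by apply: sub_all Bge => y; lia.
have := IH _ B um1 (esym lm1) Bge1.
rewrite [L 0 m.+2]lettersSr [U 0 m.+1]lettersSr !add0n -lm um um1 => IHe.
rewrite !(sort_word_cat, sort_word_rcons) Bfar Ufar.
have E : u m.+1 = u m + 1 by lia.
have := IHe f; rewrite !(sort_word_cat, sort_word_rcons) => {}IHe.
by rewrite E -sort_at_braid IHe.
Qed.

(** Entries are dropped from left to right. At column [k] the letters between the rest of the lower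
    row and the copy [u k] are the upper entries before column [k], which the second hypothesis
    keeps at distance 2 from [l k]; at column 0 there are none. *)
Lemma sort_filter_lower f n (a : pred nat) :
  (forall c, a c -> lo < l c < hi -> u c = l c) ->
  (forall c, a c.+1 -> lo < l c.+1 < hi -> u c + 2 <= l c.+1) ->
  sort_word f ([seq v <- [seq l c | c <- iota 0 n & ~~ a c] | lo < v < hi]
               ++ U 0 n) =
  sort_word f (L 0 n ++ U 0 n).
Proof.
move=> a_eq a_far.
pose K k := [seq v <- [seq l c | c <- iota 0 k & ~~ a c] | lo < v < hi].
have KS k : K k.+1 =
    if ~~ a k && (lo < l k < hi) then rcons (K k) (l k) else K k.
  rewrite /K -addn1 iotaD filter_cat map_cat filter_cat /= add0n.
  by case: (a k) => /=; [|case: ifP]; rewrite ?cats1 ?cats0.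
suff IH k : (k <= n)%N -> sort_word f (K k ++ L k (n - k) ++ U 0 n) =
                       sort_word f (L 0 n ++ U 0 n).
  by rewrite -(IH n) // subnn.
elim: k => [|k IH] kn; first by rewrite subn0.
rewrite -{}IH ?(ltnW kn) // KS -(subnSK kn) lettersS.
case: (boolP (lo < l k < hi)) => lk; rewrite ?andbF // andbT.
case: (boolP (a k)) => ak /=; last by rewrite cat_rcons.
rewrite sort_word_cat [RHS]sort_word_cat.
have -> : U 0 n = U 0 k ++ U k (n - k.+1).+1.
  have := letters_cat lo hi u 0 k (n - k).
  by rewrite add0n subnKC -?(subnSK kn) // ltnW.
rewrite sort_drop_lower ?a_eq //.
case: k kn lk ak {KS} => [//|k] kn lk ak.
apply/allP => y /lettersP[c [/andP[_ ck] -> uc]].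
have := incr_leq u_incr (ck : (c <= k)%N); have := a_far _ ak lk; lia.
Qed.

(** Entries are dropped from right to left, by induction on [n - k]. The letters between [l j] and
    [u j] that need separating are the lower entries after column [j], and the second hypothesis
    supplies the distance 2. *)
Lemma sort_filter_upper f n (a : pred nat) :
  (forall c, a c -> lo < u c < hi -> u c = l c) ->
  (forall c, a c -> lo < u c < hi -> u c + 2 <= l c.+1) ->
  sort_word f (L 0 n ++
    [seq v <- [seq u c | c <- iota 0 n & ~~ a c] | lo < v < hi]) =
  sort_word f (L 0 n ++ U 0 n).
Proof.
move=> a_eq a_far.
pose K k m := [seq v <- [seq u c | c <- iota k m & ~~ a c] | lo < v < hi].
suff IH k : (k <= n)%N -> sort_word f (L 0 n ++ U 0 k ++ K k (n - k)%N) =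
                       sort_word f (L 0 n ++ U 0 n).
  by rewrite -(IH 0) // subn0.
move/subKn => <-; elim: (n - k)%N (leq_subr k n) => {k} [|k IH] kn.
  by rewrite subn0 subnn cats0.
rewrite -IH ?(ltnW kn) // !subKn // ?(ltnW kn) //.
set j := (n - k.+1)%N; have -> : (n - k = j.+1)%N by rewrite /j; lia.
have -> : K j k.+1 =
    if ~~ a j && (lo < u j < hi) then u j :: K j.+1 k else K j.+1 k.
  by rewrite /K /=; case: (a j).
rewrite lettersSr add0n.
case: (boolP (lo < u j < hi)) => uj; rewrite ?andbF // andbT.
case: (boolP (a j)) => aj /=; last by rewrite cat_rcons.
rewrite !catA [LHS]sort_word_cat [RHS]sort_word_cat.
have -> : L 0 n = L 0 j.+1 ++ L j.+1 (n - j.+1).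
  have := letters_cat lo hi l 0 j.+1 (n - j.+1).
  by rewrite add0n subnKC //; rewrite /j; lia.
rewrite -!catA (sort_drop_upper _ uj (a_eq _ aj uj)) //.
apply/allP => y /lettersP[c [/andP[jc _] -> lc]].
have := incr_leq l_incr jc; have := a_far _ aj uj; lia.
Qed.

End TwoRows.

(** * Slides of a filling of the quadrant *)

(* A tableau of shape nu/lam is extended to a strictly increasing function on
   the whole quadrant, with values at most [lo] on lam and at least [hi] outside
   nu.  A slide is then defined everywhere, and its dots never stop. *)
Definition strictly_increasing (t : nat -> nat -> int) : Prop :=
  forall r c, t r c < t r c.+1 /\ t r c < t r.+1 c.

(** The value with which a dot in this box is exchanged; if both neighbors carry it, the dot goes
    both ways. *)
Definition next_value (t : nat -> nat -> int) (r c : nat) : int :=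
  Num.min (t r c.+1) (t r.+1 c).

(* The boxes that contain a dot at some moment of the slide. *)
Inductive visited (t : nat -> nat -> int) (C : {fset box}) :
    nat -> nat -> Prop :=
| visited_start r c : ((r, c) : box) \in C -> visited t C r c
| visited_right r c : visited t C r c -> next_value t r c = t r c.+1 ->
    visited t C r c.+1
| visited_down r c : visited t C r c -> next_value t r c = t r.+1 c ->
    visited t C r.+1 c.

Definition slid t C (r c : nat) : int :=
  if `[< visited t C r c >] then next_value t r c else t r c.

Definition rows_concat (R : nat -> seq int) (k n : nat) : seq int :=
  flatten [seq R r | r <- rev (iota k n)].

Lemma rows_concatS R k n : rows_concat R k n.+1 = rows_concat R k.+1 n ++ R k.
Proof. by rewrite /rows_concat /= rev_cons map_rcons flatten_rcons. Qed.

Lemma rows_concatSr R k n :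
  rows_concat R k n.+1 = R (k + n)%N ++ rows_concat R k n.
Proof. by rewrite /rows_concat -addn1 iotaD rev_cat. Qed.

Definition rows_word lo hi (N : nat) (t : nat -> nat -> int) (k n : nat) :=
  rows_concat (fun r => letters lo hi (t r) 0 N) k n.

Section Slide.

Variables (lo hi : int) (t : nat -> nat -> int) (C : {fset box}).
Hypothesis t_incr : strictly_increasing t.
(** The form taken by maximality in the inner shape [t <= lo]: the box belongs to it, and its right
    and lower neighbors do not. *)
Hypothesis C_corner :
  forall r c, ((r, c) : box) \in C -> t r c <= lo < next_value t r c.

Local Notation t' := (slid t C).
Local Notation vis := (visited t C).

Lemma next_value_gt r c : t r c < next_value t r c.
Proof. by have [] := t_incr r c; rewrite /next_value; lia. Qed.

Lemma next_value_right r c : next_value t r c <= t r c.+1.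
Proof. by rewrite /next_value; lia. Qed.

Lemma next_value_down r c : next_value t r c <= t r.+1 c.
Proof. by rewrite /next_value; lia. Qed.

Lemma next_valueP r c :
  next_value t r c = t r c.+1 \/ next_value t r c = t r.+1 c.
Proof. by rewrite /next_value; lia. Qed.

Lemma visited_inv r c : vis r c ->
  [\/ ((r, c) : box) \in C,
      exists2 c1, c = c1.+1 & vis r c1 /\ next_value t r c1 = t r c |
      exists2 r1, r = r1.+1 & vis r1 c /\ next_value t r1 c = t r c].
Proof.
case=> {}r {}c; first by constructor 1.
  by move=> v E; constructor 2; exists c.
by move=> v E; constructor 3; exists r.
Qed.

Lemma visited_next_gt r c : vis r c -> lo < next_value t r c.
Proof.
elim=> {}r {}c; first by case/C_corner/andP.
  by move=> _ lt_lo E; have := next_value_gt r c.+1; lia.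
by move=> _ lt_lo E; have := next_value_gt r.+1 c; lia.
Qed.

Lemma visited_gt r c : vis r c -> ((r, c) : box) \in C \/ lo < t r c.
Proof.
by case=> {}r {}c; [left | move=> /visited_next_gt + <-; right ..].
Qed.

Lemma visited_slid r c : vis r c -> t' r c = next_value t r c.
Proof. by move=> v; rewrite /slid asboolT. Qed.

Lemma nonvisited_slid r c : ~ vis r c -> t' r c = t r c.
Proof. by move=> v; rewrite /slid asboolF. Qed.

Lemma slid_ge r c : t r c <= t' r c.
Proof. by rewrite /slid; case: ifP; have := next_value_gt r c; lia. Qed.

Lemma slid_le_down r c : t' r c <= t r.+1 c.
Proof.
have := next_value_down r c; have [] := t_incr r c.
by rewrite /slid; case: ifP; lia.
Qed.

(** If the new entry of a box is the old entry of a neighbor, then the dot has moved to that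
    neighbor, whose entry therefore grows as well. *)
Lemma slid_incr : strictly_increasing t'.
Proof.
move=> r c; have [lt_r lt_d] := t_incr r c.
have [v|nv] := EM (vis r c); last first.
  rewrite nonvisited_slid //; split.
    exact: lt_le_trans lt_r (slid_ge _ _).
  exact: lt_le_trans lt_d (slid_ge _ _).
rewrite visited_slid //; split.
  have [E|ne] := eqVneq (next_value t r c) (t r c.+1).
    rewrite E visited_slid; first exact: next_value_gt.
    exact: visited_right.
  by have := next_value_right r c; have := slid_ge r c.+1; lia.
have [E|ne] := eqVneq (next_value t r c) (t r.+1 c).
  rewrite E visited_slid; first exact: next_value_gt.
  exact: visited_down.
by have := next_value_down r c; have := slid_ge r.+1 c; lia.
Qed.

(** Every visited box ends above [lo], and outside [C] it also starts above [lo]; hence the inner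
    shape loses just the boxes of [C]. *)
Lemma slid_le_lo r c :
  (t' r c <= lo) = (t r c <= lo) && (((r, c) : box) \notin C).
Proof.
have [v|nv] := EM (vis r c).
  rewrite visited_slid //; have := visited_next_gt v; have := visited_gt v.
  by case: (_ \in C) => -[]//=; lia.
rewrite nonvisited_slid //; case: (boolP (_ \in C)) => [/visited_start //|].
by rewrite andbT.
Qed.

(* [enters r c]: a dot comes into row [r] at column [c] from above only, so the
   entry [t r c] leaves the row.  [exits r c]: the dot moves down only, so the
   new entry of the box comes from row [r.+1]. *)
Let from_left r c := if c is c1.+1 then
  `[< vis r c1 >] && (next_value t r c1 == t r c) else false.

Let enters r c := `[< vis r c >] && ~~ from_left r c.

Let exits r c := `[< vis r c >] && (next_value t r c < t r c.+1).

(** A value above [lo] excludes a starting box, and [enters] excludes arrival from the left, so only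
    arrival from above remains. *)
Lemma enters_above r c : enters r.+1 c -> lo < t r.+1 c ->
  vis r c /\ next_value t r c = t r.+1 c.
Proof.
case/andP=> /asboolP/visited_inv[rcC|[c1 -> [v E]]|[r1 [<-] //]] nl lt_lo.
  by have := C_corner rcC; lia.
by move: nl; rewrite /= E eqxx asboolT.
Qed.

Lemma enters_top c : lo < t 0%N c -> enters 0%N c = false.
Proof.
move=> lt_lo; apply/negP.
case/andP=> /asboolP/visited_inv[rcC|[c1 -> [v E]]|[] //].
  by have := C_corner rcC; lia.
by rewrite /= E eqxx asboolT.
Qed.

Variable N : nat.
Hypothesis t_wide : forall r, hi <= t r N.

Local Notation row f r := (letters lo hi (f r) 0 N).

Let staying r :=
  [seq v <- [seq t r c | c <- iota 0 N & ~~ enters r c] | lo < v < hi].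

(** Both lists are sorted, so only their members are compared. A staying entry either keeps its box
    or moves one column left, into the box of a dot that moves right. *)
Lemma stayingE r : staying r =
  [seq v <- [seq t' r c | c <- iota 0 N & ~~ exits r c] | lo < v < hi].
Proof.
apply: lt_sorted_eq.
- by apply: incr_filter_sorted => c; have [] := t_incr r c.
- by apply: incr_filter_sorted => c; have [] := slid_incr r c.
move=> v; rewrite !mem_filter; case: (boolP (lo < v < hi)) => //= lv.
apply/mapP/mapP => -[c];
    rewrite mem_filter mem_iota => /andP[nc /andP[_ cN]] Ev.
  have [vc|nvc] := EM (vis r c); last first.
    exists c; last by rewrite nonvisited_slid.
    by rewrite mem_filter mem_iota cN /exits asboolF.
  move: nc; rewrite /enters asboolT //= negbK.
  case: c cN Ev vc => //= c cN Ev vc /andP[/asboolP v1 /eqP E].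
  exists c; last by rewrite visited_slid // E.
  by rewrite mem_filter mem_iota (ltnW cN) /exits E ltxx andbF.
have [vc|nvc] := EM (vis r c); last first.
  exists c; last by rewrite -nonvisited_slid.
  by rewrite mem_filter mem_iota cN /enters asboolF.
move: nc Ev; rewrite visited_slid // /exits asboolT //= -leNgt => le_n Ev.
have E : next_value t r c = t r c.+1 by have := next_value_right r c; lia.
exists c.+1; last by rewrite -E.
rewrite mem_filter /enters /from_left (asboolT vc) E eqxx andbF mem_iota.
(* Column [c.+1] is still before [N], because its entry is below [hi] while column [N] starts at
   [hi] or more. *)
have := t_wide r; case: (ltngtP c.+1 N) => [//||cEN]; last by rewrite -cEN; lia.
by move=> /=; lia.
Qed.

(** An entry that leaves row [r.+1] upwards reappears in the same column of the new row [r], so it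
    is a duplicate that the lower row may lose. *)
Lemma drop_entering f r : sort_word f (staying r.+1 ++ row t' r) =
                          sort_word f (row t r.+1 ++ row t' r).
Proof.
apply: sort_filter_lower => [c||c|c en lc|c en lc].
- by have [] := t_incr r.+1 c.
- by move=> c; have [] := slid_incr r c.
- exact: slid_le_down.
- have [v E] := enters_above en (proj1 (andP lc)).
  by rewrite visited_slid.
have := slid_le_down r c; have [lt1 _] := t_incr r.+1 c.
(* A gap of exactly 1 would force a dot down from [(r, c)] and then right into [(r.+1, c.+1)],
   contradicting that the latter is entered from above only. *)
have [E|] := eqVneq (t' r c + 1) (t r.+1 c.+1); last by lia.
have Eu : t' r c = t r.+1 c by have := slid_le_down r c; lia.
have v : vis r c.
  apply: contrapT => nv; have [_ lt2] := t_incr r c.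
  by rewrite nonvisited_slid // in Eu; lia.
have vd : vis r.+1 c by apply: visited_down; rewrite // -visited_slid.
have E1 : next_value t r.+1 c = t r.+1 c.+1.
  by have [_] := t_incr r.+1 c; rewrite /next_value; lia.
by move: en; rewrite /enters /= E1 eqxx (asboolT vd) andbF.
Qed.

(** An entry coming up from row [r.+1] is still present in the old reading of that row. The old
    entry [t r c.+1] lies strictly between it and the next lower entry, which gives the distance
    2. *)
Lemma add_exiting f r : sort_word f (row t r.+1 ++ staying r) =
                        sort_word f (row t r.+1 ++ row t' r).
Proof.
rewrite stayingE; apply: sort_filter_upper => [c|c|c|c|c].
- by have [] := t_incr r.+1 c.
- by have [] := slid_incr r c.
- exact: slid_le_down.
- case/andP=> /asboolP v lt_n _; rewrite visited_slid //.
  by have [E|//] := next_valueP r c; lia.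
case/andP=> /asboolP v lt_n _; rewrite visited_slid //.
have [_ lt1] := t_incr r c.+1.
by have := next_value_right r c; lia.
Qed.

(** Stage of the row-by-row slide with the top [k] rows done. Row [k] first loses its entering
    letters against the new row above it, then gains its exiting letters against the old row below
    it. *)
Lemma slid_word f n k : hi <= t (k + n)%N 0%N ->
  sort_word f (rows_word lo hi N t k n ++ rows_word lo hi N t' 0 k) =
  sort_word f (rows_word lo hi N t' 0 (k + n)).
Proof.
elim: n k f => [|n IH] k f t_tall; first by rewrite addn0.
have drop g : sort_word g (row t k ++ rows_word lo hi N t' 0 k) =
              sort_word g (staying k ++ rows_word lo hi N t' 0 k).
  case: k {t_tall} => [|k]; last first.
    rewrite [rows_word _ _ _ t' _ _]rows_concatSr !catA [RHS]sort_word_cat.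
    by rewrite drop_entering -sort_word_cat.
  congr (sort_word _ (_ ++ _)); rewrite /letters /staying.
  rewrite !filter_map; congr map; rewrite -filter_predI.
  apply: eq_filter => c /=.
  case: (boolP (lo < t 0%N c < hi)) => //= /andP[lt_lo _].
  by rewrite enters_top.
have add g : sort_word g (rows_word lo hi N t k.+1 n ++ staying k) =
             sort_word g (rows_word lo hi N t k.+1 n ++ row t' k).
  (* In the last row there is no row below in the word, but row [k.+1] has no letters under [hi], so
     [add_exiting] applies with an empty row. *)
  case: n {IH} t_tall => [|n] t_tall; last first.
    rewrite [rows_word _ _ _ _ _ n.+1]rows_concatS -!catA sort_word_cat.
    by rewrite add_exiting -sort_word_cat.
  have := add_exiting g k; suff -> : row t k.+1 = [::] by [].
  apply/eqP; rewrite -[_ == _]negbK -has_filter; apply/hasPn => v.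
  case/mapP => c _ ->; rewrite addn1 in t_tall.
  have := incr_leq (fun e => proj1 (t_incr k.+1 e)) (leq0n c); lia.
rewrite [rows_word _ _ _ _ _ n.+1]rows_concatS -catA sort_word_cat drop.
rewrite -sort_word_cat catA sort_word_cat add.
rewrite -sort_word_cat -catA.
by rewrite -(rows_concatSr (fun r => row t' r) 0 k) IH ?addSnnS.
Qed.

End Slide.

(** * Swaps compute the slide *)

Lemma box_leE (r c r' c' : nat) :
  (((r, c) : box) <= (r', c'))%O = (r <= r')%N && (c <= c')%N.
Proof. by rewrite leEprod. Qed.

Lemma box_ltE (r c r' c' : nat) : (((r, c) : box) < (r', c'))%O =
  [&& (r <= r')%N, (c <= c')%N & (r + c < r' + c')%N].
Proof.
by rewrite lt_neqAle box_leE xpair_eqE; lia.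
Qed.

Lemma covers_boxE (r c r' c' : nat) : covers (r', c') (r, c) =
  ((r' == r.+1) && (c' == c)) || ((r' == r) && (c' == c.+1)).
Proof.
apply/coversP/idP => [[lt no]|].
  apply: contraPT lt => ne lt; rewrite box_ltE in lt.
  have [rr|rr] := ltnP r r'.
    by case: (no (r.+1, c)); rewrite !box_ltE; lia.
  by case: (no (r, c.+1)); rewrite !box_ltE; lia.
move=> E; split; first by rewrite box_ltE; lia.
by move=> [r1 c1]; rewrite !box_ltE; lia.
Qed.

Lemma neighbors_boxE (r c r' c' : nat) : neighbors (r, c) (r', c') =
  [|| (r' == r.+1) && (c' == c), (r' == r) && (c' == c.+1),
      (r == r'.+1) && (c == c') | (r == r') && (c == c'.+1)].
Proof. by rewrite /neighbors !covers_boxE; lia. Qed.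

Lemma fnd_swap (S : eqType) (s s' : S) (Y : {fmap box -> S}) (b : box) :
  let next_to v := `[< exists2 b', neighbors b b' & Y.[? b'] = Some v >] in
  (swap s s' Y).[? b] = omap (fun y =>
    if (y == s) && next_to s' then s'
    else if (y == s') && next_to s then s else y) Y.[? b].
Proof.
move=> next_to.
case: (fndP Y b) => [bY|bY]; last by rewrite not_fnd.
have nextE v : [exists b' : domf Y, neighbors b (val b') && (Y b' == v)] =
               next_to v.
  apply/existsP/asboolP => [[b' /andP[nb /eqP Yb]]|[b' nb Yb]].
    exists (val b') => //; rewrite (in_fnd (valP b')) -Yb.
    by congr (Some (Y _)); apply: val_inj.
  have b'Y : b' \in domf Y by rewrite -fndSome Yb.
  exists [` b'Y]; rewrite nb /=; apply/eqP; apply: Some_inj.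
  by rewrite -Yb (in_fnd b'Y).
rewrite (in_fnd (bY : b \in domf (swap s s' Y))) /swap ffunE /=.
by rewrite !nextE; do 2!congr (Some _).
Qed.

Definition represents lo hi (t : nat -> nat -> int) (T : {fmap box -> int}) :=
  forall r c : nat,
    T.[? (r, c)] = if lo < t r c < hi then Some (t r c) else None.

(* The content of a box just before the swap of [s] with the dots. *)
Definition slide_stage t C (s : int) (r c : nat) : option int :=
  if `[< visited t C r c >] then
    if s <= t r c then Some (t r c)
    else if next_value t r c < s then Some (next_value t r c) else dot
  else Some (t r c).

Definition slide_shape lo hi (t : nat -> nat -> int) (C : {fset box}) r c :=
  (lo < t r c < hi) || (((r, c) : box) \in C).

Definition at_stage lo hi t C (s : int) (Y : {fmap box -> option int}) : Prop :=
  forall r c : nat, Y.[? (r, c)] =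
    if slide_shape lo hi t C r c then Some (slide_stage t C s r c) else None.

Section Jdt.

Variables (lo hi : int) (t : nat -> nat -> int) (C : {fset box}).
Hypothesis t_incr : strictly_increasing t.
Hypothesis C_corner :
  forall r c, ((r, c) : box) \in C -> t r c <= lo < next_value t r c.

Local Notation vis := (visited t C).
Local Notation stage := (slide_stage t C).
Local Notation shape := (slide_shape lo hi t C).
Local Notation staged := (at_stage lo hi t C).

Lemma slide_stage_dot s r c :
  stage s r c = dot <-> [/\ vis r c, t r c < s & s <= next_value t r c].
Proof.
rewrite /slide_stage /dot; case: asboolP => v; last by split => // -[].
case: (leP s (t r c)) => [le_s|lt_s]; first by split => // -[].
by case: (ltP (next_value t r c) s) => [lt_n|le_n]; split => // -[].
Qed.

Lemma slide_stage_some s r c : stage s r c = Some s <-> t r c = s.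
Proof.
rewrite /slide_stage /dot; case: asboolP => v; last by split => [[]|->].
case: (leP s (t r c)) => [le_s|lt_s]; first by split => [[]|->].
case: (ltP (next_value t r c) s) => [lt_n|le_n]; first by split => [[]|]; lia.
by split => // ts; lia.
Qed.

(** A box to the right of or below an entry [s] has a larger original entry, so it cannot hold a dot
    yet. A dot to the left or above has [s] as its next value, and so is about to visit this box. *)
Lemma next_to_dot s Y r c : lo < s < hi -> staged s Y -> t r c = s ->
  (exists2 b', neighbors (r, c) b' & Y.[? b'] = Some dot) <-> vis r c.
Proof.
move=> s_range Ys ts; split.
  move=> [[r' c']]; rewrite neighbors_boxE Ys.
  case: ifP => // _ + [/slide_stage_dot].
  have [lt_r lt_d] := t_incr r c.
  case/or4P => /andP[/eqP Er /eqP Ec] [v lt_s le_s]; subst.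
  - by lia.
  - by lia.
  - by apply: visited_down => //; have := next_value_down t r' c'; lia.
  - by apply: visited_right => //; have := next_value_right t r' c'; lia.
case/visited_inv => [/C_corner|[c1 Ec [v E]]|[r1 Er [v E]]]; first by lia.
  exists (r, c1); first by rewrite neighbors_boxE Ec !eqxx !orbT.
  have lt_s : t r c1 < s by rewrite -ts Ec; have [] := t_incr r c1.
  have -> := Ys r c1; have -> : shape r c1.
    by rewrite /slide_shape; have [->|] := visited_gt t_incr C_corner v; lia.
  by congr Some; apply/slide_stage_dot; split => //; lia.
exists (r1, c); first by rewrite neighbors_boxE Er !eqxx !orbT.
have lt_s : t r1 c < s by rewrite -ts Er; have [] := t_incr r1 c.
have -> := Ys r1 c; have -> : shape r1 c.
  by rewrite /slide_shape; have [->|] := visited_gt t_incr C_corner v; lia.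
by congr Some; apply/slide_stage_dot; split => //; lia.
Qed.

Lemma next_to_value s Y r c : lo < s < hi -> staged s Y ->
  t r c < s <= next_value t r c ->
  (exists2 b', neighbors (r, c) b' & Y.[? b'] = Some (Some s)) <->
  next_value t r c = s.
Proof.
move=> s_range Ys ts; split.
  move=> [[r' c']]; rewrite neighbors_boxE Ys.
  case: ifP => // _ + [/slide_stage_some].
  case/or4P => /andP[/eqP Er /eqP Ec] E; subst.
  - by have := next_value_down t r c; lia.
  - by have := next_value_right t r c; lia.
  - by have [] := t_incr r' c'; lia.
  - by have [] := t_incr r' c'; lia.
move=> E; have [E1|E1] := next_valueP t r c.
  exists (r, c.+1); first by rewrite neighbors_boxE !eqxx !orbT.
  have -> := Ys r c.+1.
  have -> : shape r c.+1 by rewrite /slide_shape -E1 E s_range.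
  by congr Some; apply/slide_stage_some; rewrite -E1.
exists (r.+1, c); first by rewrite neighbors_boxE !eqxx.
have -> := Ys r.+1 c.
have -> : shape r.+1 c by rewrite /slide_shape -E1 E s_range.
by congr Some; apply/slide_stage_some; rewrite -E1.
Qed.

Lemma swap_staged s Y : lo < s < hi -> staged s Y ->
  staged (s + 1) (swap (Some s) dot Y).
Proof.
move=> s_range Ys r c; rewrite fnd_swap Ys; case: ifP => //= _; congr Some.
have n_gt := next_value_gt t_incr r c.
case: (eqVneq (stage s r c) (Some s)) =>
    [/[dup] Es /slide_stage_some ts|ne_s] /=.
  rewrite (asbool_equiv_eq (next_to_dot s_range Ys ts)) Es /=.
  rewrite /slide_stage; case: asboolP => v /=; last by rewrite ts.
  case: (leP (s + 1) (t r c)); first by lia.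
  by case: (ltP (next_value t r c) (s + 1)); first by lia.
case: (eqVneq (stage s r c) dot) =>
    [/[dup] Es /slide_stage_dot [v lt_s le_s]|ne_d] /=.
  have ts : t r c < s <= next_value t r c by rewrite lt_s.
  rewrite (asbool_equiv_eq (next_to_value s_range Ys ts)) Es.
  rewrite /slide_stage (asboolT v); case: (leP (s + 1) (t r c)); first by lia.
  by case: asboolP => [->|ne] _; case: (ltP _ (s + 1)) => //; lia.
move: ne_s ne_d; rewrite /slide_stage; case: asboolP => v //.
case: (leP s (t r c)) => [le_s|lt_s].
  move=> ne_s _; case: (leP (s + 1) (t r c)) => // lt1.
  by case: eqP ne_s => // -[]; congr Some; lia.
case: (ltP (next_value t r c) s) => // lt_n _ _.
case: (leP (s + 1) (t r c)); first by lia.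
by case: (ltP (next_value t r c) (s + 1)) => //; lia.
Qed.

Lemma swaps_staged s n Y : lo < s -> s + n%:Z <= hi -> staged s Y ->
  staged (s + n%:Z) (foldl (fun Z v => swap (Some v) dot Z) Y
                           [seq s + k%:Z | k <- iota 0 n]).
Proof.
move=> lo_s; elim: n => [|n IH] s_hi Ys; first by rewrite addr0.
rewrite -addn1 iotaD map_cat foldl_cat /= PoszD addrA.
by apply: swap_staged; [lia | apply: IH => //; lia].
Qed.

End Jdt.

(** The values swapped are exactly the integers strictly between [lo] and [hi]; the maximum in [hi]
    covers the empty range [b < a]. *)
Lemma jdt_represents t C a b T : strictly_increasing t ->
  let lo := a - 1 in let hi := Num.max a (b + 1) in
  (forall r c, ((r, c) : box) \in C -> t r c <= lo < next_value t r c) ->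
  represents lo hi t T -> represents lo hi (slid t C) (jdt a b C T).
Proof.
move=> t_incr lo hi C_corner tT r c; rewrite /jdt fnd_reducef.
have -> : int_range a b = [seq a + k%:Z | k <- iota 0 `|hi - a|%N].
  rewrite /int_range; case: leP => ab; first by congr map; congr iota; lia.
  by have -> : `|hi - a|%N = 0%N by rewrite /hi; lia.
have hiE : hi = a + `|hi - a|%N%:Z by rewrite /hi; lia.
have lo_a : lo < a by rewrite /lo; lia.
have Y0 : at_stage lo hi t C a (add_dots C T).
  move=> {}r {}c; rewrite /add_dots.
  have dT : (((r, c) : box) \in domf T) = (lo < t r c < hi).
    by rewrite -fndSome tT; case: ifP.
  have dY : (((r, c) : box) \in domf T `|` C) = slide_shape lo hi t C r c
    by rewrite in_fsetU dT.
  case: (boolP (slide_shape _ _ _ _ _ _)) => rc; last by rewrite not_fnd //= dY.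
  rewrite -dY in rc; rewrite in_fnd ffunE /= tT; congr Some.
  rewrite /slide_stage; case: ifP => t_range.
    have -> : a <= t r c by lia.
    by case: asboolP.
  have rcC : ((r, c) : box) \in C by move: rc; rewrite dY /slide_shape t_range.
  rewrite asboolT; last exact: visited_start.
  have rc_corner := C_corner _ _ rcC.
  have -> : (a <= t r c) = false by lia.
  by have -> : (next_value t r c < a) = false by lia.
have := swaps_staged t_incr C_corner lo_a (_ : a + `|hi - a|%N%:Z <= hi) Y0.
rewrite -hiE => /(_ (lexx _)) ->.
rewrite /slide_stage /slid /slide_shape; case: ifP => [|/negbT]; last first.
  rewrite negb_or => /andP[t_out rcC]; case: asboolP => v; last first.
    by rewrite (negPf t_out).
  case: (visited_gt t_incr C_corner v); first by rewrite (negPf rcC).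
  by have := next_value_gt t_incr r c; case: ifP => //; lia.
(* After all swaps a dot remains where [next_value] is at least [hi], and these boxes are
   deleted. *)
case: asboolP => v rc /=.
  have := visited_next_gt t_incr C_corner v => -> /=.
  have -> : (hi <= t r c) = false.
    by case/orP: rc => [|/C_corner]; lia.
  by case: ltP.
case/orP: rc => [->//|/(visited_start t) //].
Qed.

(** * Recovering rows from the Hecke product *)

Definition run (m : int) (k : nat) : seq int := [seq m + j%:Z | j <- iota 0 k].

Lemma run_rcons m k : run m k.+1 = rcons (run m k) (m + k%:Z).
Proof. by rewrite /run -addn1 iotaD map_cat cats1. Qed.

Lemma run_cons m k : run m k.+1 = m :: run (m + 1) k.
Proof.
rewrite /run /= addr0; congr cons; rewrite -[1%N]addn0 iotaDl -map_comp.
by apply: eq_map => j /=; rewrite PoszD addrA.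
Qed.

(** The run is taken maximal, so the remaining letters skip the value [m + k]. *)
Lemma sorted_run_split m s : sorted <%O s -> all (>= m) s ->
  exists k Z, s = run m k ++ Z /\ all (> (m + k%:Z)) Z.
Proof.
elim: s m => [|x s IH] m; first by exists 0%N, [::].
rewrite /= (path_sortedE lt_trans) => /andP[x_lt s_sorted] /andP[mx _].
have [xm|xm] := eqVneq x m; last first.
  exists 0%N, (x :: s); split => //=; apply/andP; split; first by lia.
  by apply: sub_all x_lt => y /=; lia.
have [|k [Z [-> Zge]]] := IH (m + 1) s_sorted.
  by apply: sub_all x_lt => y /=; lia.
exists k.+1, Z; rewrite run_cons xm; split => //.
by apply: sub_all Zge => y /=; lia.
Qed.

Lemma sort_word_fix f s q p :
  all (> q) s -> p <= q -> sort_word f s p = f p.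
Proof.
elim: s f => // x s IH f /= /andP[qx qs] pq.
by rewrite sort_word_cons IH // /sort_at; repeat (case: eqP => ?; try lia).
Qed.

Lemma sort_word_gt f s q : (forall p, q < p -> q < f p) -> all (> q) s ->
  forall p, q < p -> q < sort_word f s p.
Proof.
elim: s f => // x s IH f fq /= /andP[qx qs]; apply: IH => // p qp.
have := fq p qp; have := fq x qx; have := fq (x + 1).
by rewrite /sort_at; repeat (case: eqP => ?; try lia).
Qed.

(** Until the first letter [m], positions above [m] hold only values above [m]. That letter brings
    such a value to position [m], and later letters cannot lower it. *)
Lemma sort_word_min m s : all (>= m) s -> m \in s -> m < sort_word id s m.
Proof.
have above f s' : m < f m -> all (>= m) s' -> m < sort_word f s' m.
  elim: s' f => // x s' IH f fm /= /andP[mx ms]; apply: IH => //.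
  rewrite /sort_at; have [<-|xm] := eqVneq m x; first by lia.
  by case: eqP; lia.
suff gen f : (forall p, m < p -> m < f p) -> all (>= m) s -> m \in s ->
    m < sort_word f s m by exact: gen.
elim: s f => // x s IH f fgt /= /andP[mx ms]; rewrite in_cons sort_word_cons.
have [<-{x mx} _|xm /= m_s] := eqVneq m x.
  by apply: above => //; rewrite /sort_at eqxx; have := fgt (m + 1); lia.
apply: IH => // p mp; have := fgt p mp; have := fgt x; have := fgt (x + 1).
by rewrite /sort_at; repeat (case: eqP => ?; try lia).
Qed.

(** The small value [m] bubbles [k] places to the right, and each value it passes moves one place
    left. *)
Lemma sort_word_run f m k : f m = m -> (forall p, m < p -> m < f p) ->
  forall p, sort_word f (run m k) p =
    if p < m then f p else if p < m + k%:Z then f (p + 1)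
    else if p == m + k%:Z then m else f p.
Proof.
move=> fm fgt; elim: k => [|k IH] p.
  rewrite addr0 /sort_word /=; case: (ltrP p m) => // _.
  by have [->|] := eqVneq p m.
rewrite run_rcons sort_word_rcons /sort_at !IH.
have := fgt (m + k%:Z + 1).
case: (ltrP p m) => pm.
  repeat (case: eqP => ?; try lia).
have [->|p1] := eqVneq p (m + k%:Z).
  rewrite eqxx.
  repeat (case: ifP => ?; try lia).
have [->|p2] := eqVneq p (m + k%:Z + 1).
  repeat (case: ifP => ?; try lia).
repeat (case: ifP => ?; try lia).
Qed.

Lemma mem_rows_concat R k n x : x \in rows_concat R k n ->
  exists2 r, (k <= r < k + n)%N & x \in R r.
Proof.
by case/flatten_mapP => r; rewrite mem_rev mem_iota => r_in x_in; exists r.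
Qed.

Section Rows.

Variables (R : nat -> seq int) (len : nat -> nat).
Hypothesis R_sorted : forall r, sorted <%O (R r).
Hypothesis R_ge : forall r, all (> r%:Z) (R r).
Hypothesis len_decr : forall r, (len r.+1 <= len r)%N.

(** Row [r] of a minimal tableau, with rows and columns numbered from 0: the entries
    [r + 1, ..., r + len r]. *)
Let M r := run r.+1%:Z (len r).

Lemma rows_gt (Q : nat -> seq int) k n : (forall r, all (> r%:Z) (Q r)) ->
  all (> k%:Z) (rows_concat Q k n).
Proof.
move=> Q_gt; apply/allP => x /mem_rows_concat[r r_in /(allP (Q_gt r)) /=]; lia.
Qed.

Lemma minimal_row_gt r : all (> r%:Z) (M r).
Proof. by apply/allP => _ /mapP[j _ ->] /=; lia. Qed.

Lemma sort_word_first_row Q k n j : (forall r, all (> r%:Z) (Q r)) ->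
  let g := sort_word id (rows_concat Q k.+1 n) in
  [/\ g k.+1%:Z = k.+1%:Z, (forall p, k.+1%:Z < p -> k.+1%:Z < g p) &
  forall p, sort_word g (run k.+1%:Z j) p =
    if p < k.+1%:Z then p else if p < k.+1%:Z + j%:Z then g (p + 1)
    else if p == k.+1%:Z + j%:Z then k.+1%:Z else g p].
Proof.
move=> Q_gt g; have gk p : p <= k.+1%:Z -> g p = p.
  by apply: sort_word_fix; apply: rows_gt.
have ggt p : k.+1%:Z < p -> k.+1%:Z < g p.
  by apply: sort_word_gt => //; apply: rows_gt.
split=> // [|p]; first exact: gk.
rewrite (sort_word_run _ (gk _ (lexx _)) ggt).
by case: (ltrP p) => // /ltW/gk.
Qed.

(** The first run leaves the small value [k.+1] at the bound itself; beyond it the bound for the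
    next row is met, since lengths weakly decrease. *)
Lemma sort_word_minimal_incr k n p : k.+1%:Z + (len k)%:Z <= p ->
  sort_word id (rows_concat M k n) p < sort_word id (rows_concat M k n) (p + 1).
Proof.
elim: n k p => [|n IH] k p kp; first by rewrite /sort_word /=; lia.
rewrite rows_concatS sort_word_cat.
have [_ ggt gE] := sort_word_first_row k n (len k) minimal_row_gt.
rewrite !gE; have := ggt (p + 1); have := IH k.+1 p; have := len_decr k.
by repeat (case: ifP => ?; try lia).
Qed.

Lemma rows_unique k n :
  sort_word id (rows_concat R k n) = sort_word id (rows_concat M k n) ->
  forall r, (k <= r < k + n)%N -> R r = M r.
Proof.
elim: n k => [|n IH] k; first by lia.
move/[dup] => E0; rewrite !rows_concatS !sort_word_cat.
set gR := sort_word id (rows_concat R _ _).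
set gM := sort_word id (rows_concat M _ _).
have R_ge1 : all (>= k.+1%:Z) (R k) by apply: sub_all (R_ge k) => y /=; lia.
have [j [Z [Rk Zge]]] := sorted_run_split (R_sorted k) R_ge1.
have [_ gRgt gRE] := sort_word_first_row k n j R_ge.
have [_ gMgt gME] := sort_word_first_row k n (len k) minimal_row_gt.
rewrite -/gR in gRgt gRE; rewrite -/gM in gMgt gME.
move=> E; have Ep p := congr1 (fun f => f p) E.
rewrite /= Rk !sort_word_cat in Ep.
(* The value [k.+1] sits at [k.+1 + j] on one side, where the letters of [Z] do not reach it, and at
   [k.+1 + len k] on the other. *)
have jE : j = len k.
  have := Ep (k.+1%:Z + j%:Z); rewrite (sort_word_fix _ Zge) // gRE gME.
  have := gMgt (k.+1%:Z + j%:Z); have := gMgt (k.+1%:Z + j%:Z + 1).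
  by repeat (case: ifP => ?; try lia).
(* The last letter [z] of [Z] would leave the values at [z] and [z + 1] in decreasing order, where
   the minimal side increases. *)
have Z0 : Z = [::].
  case/lastP: Z Zge Ep {Rk} => // Z z; rewrite all_rcons => /andP[zge _] Ep.
  have := sort_word_minimal_incr (k := k) n.+1 (p := z).
  rewrite rows_concatS sort_word_cat -!Ep sort_word_rcons /sort_at eqxx.
  have -> : (z + 1 == z) = false by lia.
  by rewrite eqxx => /(_ _); lia.
have RM : R k = M k by rewrite Rk Z0 cats0 jE.
suff /IH RMr : gR = gM.
  move=> r; case: (eqVneq r k) => [-> //|rk] r_in; apply: RMr; lia.
apply/funext => p; have [pk|pk] := lerP p k.+1%:Z.
  rewrite /gR /gM !(sort_word_fix _ (rows_gt _ _ _)) //.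
  exact: minimal_row_gt.
have {}Ep q : sort_word gR (run k.+1%:Z j) q = sort_word gM (M k) q.
  by rewrite -Ep Z0.
(* The run sends the value at [p] to [p - 1] or leaves it at [p], so one of these two positions
   gives the claim. *)
have := Ep p; have := Ep (p - 1); rewrite !gRE !gME jE subrK.
by repeat (case: ifP => ?; try lia).
Qed.

End Rows.

(** * Tableaux and fillings *)

Lemma incr_box t r c r' c' : strictly_increasing t ->
  (r <= r')%N -> (c <= c')%N -> t r c + (r' - r)%:Z + (c' - c)%:Z <= t r' c'.
Proof.
move=> t_incr rr cc.
have := incr_leq (g := t r') (fun e => proj1 (t_incr r' e)) cc.
have := incr_leq (g := fun e => t e c) (fun e => proj2 (t_incr e c)) rr.
by lia.
Qed.

(** Finiteness holds because entries grow by at least one per step, which confines the boxes to the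
    square below [(n, n)]. *)
Lemma sublevel_shape t v : strictly_increasing t ->
  exists2 s : {fset box}, straight_shape s &
    forall r c, (((r, c) : box) \in s) = (t r c < v).
Proof.
move=> t_incr; pose n := `|v - t 0%N 0%N|%N.
have sE r c : (((r, c) : box) \in [fset b in below (n, n) | t b.1 b.2 < v]) =
              (t r c < v).
  rewrite !inE /= mem_below box_leE andb_idl // => t_v.
  by have := incr_box t_incr (leq0n r) (leq0n c); lia.
eexists; last exact: sE.
move=> [r c] [r' c']; rewrite box_leE !sE => /andP[rr cc].
by have := incr_box t_incr rr cc; lia.
Qed.

Lemma represents_domf lo hi t T r c : represents lo hi t T ->
  (((r, c) : box) \in domf T) = (lo < t r c < hi).
Proof. by move=> tT; rewrite -fndSome tT; case: ifP. Qed.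

Lemma represents_increasing lo hi t T : lo < hi -> strictly_increasing t ->
  represents lo hi t T -> increasing_tableau T.
Proof.
move=> lo_hi t_incr tT; split.
  have [nu nu_str nuE] := sublevel_shape hi t_incr.
  have [lam lam_str lamE] := sublevel_shape (lo + 1) t_incr.
  exists nu, lam; split=> //.
    by apply/fsubsetP => -[r c]; rewrite lamE nuE; lia.
  apply/fsetP => -[r c].
  by rewrite in_fsetD lamE nuE (represents_domf _ _ tT); lia.
move=> [[r c] rcT] [[r' c'] rcT'] /=; rewrite box_ltE => /and3P[rr cc lt_rc].
have := in_fnd rcT; have := in_fnd rcT'; rewrite !tT.
have := incr_box t_incr rr cc.
by case: ifP => // _; case: ifP => // _ ? -[<-] [<-]; lia.
Qed.

Lemma incr_extension T nu lam lo hi : increasing_tableau T ->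
  straight_shape nu -> straight_shape lam -> domf T = nu `\` lam ->
  lo < hi -> (forall b v, T.[? b] = Some v -> lo < v < hi) ->
  exists t, [/\ strictly_increasing t, represents lo hi t T &
    forall r c, (t r c <= lo) = (((r, c) : box) \in lam)].
Proof.
move=> [_ T_incr] nu_str lam_str domT lo_hi T_range.
pose n := (\max_(b <- lam) (b.1 + b.2))%N.
have n_ge r c : ((r, c) : box) \in lam -> (r + c <= n)%N.
  pose sum_of (b : box) := (b.1 + b.2)%N.
  by move=> /(leq_bigmax_seq (P := xpredT) (F := sum_of)); apply.
(* Subtracting [n], the largest [r + c] on [lam], keeps the inner values at most [lo]; outside [nu]
   the values start from [hi]. *)
pose t r c := if ((r, c) : box) \in lam then lo - n%:Z + (r + c)%:Z
  else if T.[? (r, c)] is Some v then v else hi + (r + c)%:Z.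
have Tdom b : (b \in T) = (b \in nu `\` lam) by rewrite -domT.
have T_lt b b' v v' : (b < b')%O ->
    T.[? b] = Some v -> T.[? b'] = Some v' -> v < v'.
  move=> bb'; case: fndP => // bT [<-]; case: fndP => // bT' [<-].
  exact: (T_incr [` bT] [` bT']).
have t_lt r c r' c' : (((r, c) : box) < (r', c'))%O -> t r c < t r' c'.
  move=> lt_b; have le_b := ltW lt_b; have := lt_b; rewrite box_ltE /t => lt_rc.
  case: (boolP (_ \in lam)) => [rc_lam|rc_nlam].
    have := n_ge _ _ rc_lam; case: (boolP (_ \in lam)) => [|_]; first by lia.
    by case E: T.[? (r', c')] => [v|]; [have := T_range _ _ E|]; lia.
  have -> : (((r', c') : box) \in lam) = false.
    by apply: contraNF rc_nlam; apply: lam_str.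
  case E: T.[? (r, c)] => [v|].
    case E': T.[? (r', c')] => [v'|]; first exact: T_lt lt_b E E'.
    by have := T_range _ _ E; lia.
  have rc_nu : ((r, c) : box) \notin nu.
    apply/negP => rc_nu; have : ((r, c) : box) \in domf T.
      by rewrite domT in_fsetD rc_nlam.
    by rewrite -fndSome E.
  rewrite not_fnd; first by lia.
  rewrite Tdom in_fsetD negb_and; apply/orP; right.
  by apply: contra rc_nu; apply: nu_str.
have Tlam r c : ((r, c) : box) \in lam -> T.[? (r, c)] = None.
  by move=> rc; rewrite not_fnd // Tdom in_fsetD rc.
exists t; split.
- by move=> r c; split; apply: t_lt; rewrite box_ltE; lia.
- move=> r c; rewrite /t; case: (boolP (_ \in lam)) => [rc_lam|_].
    by rewrite Tlam //; have := n_ge _ _ rc_lam; case: ifP => //; lia.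
  case E: T.[? (r, c)] => [v|]; first by rewrite (T_range _ _ E).
  by case: ifP => //; lia.
move=> r c; rewrite /t; case: (boolP (_ \in lam)) => [rc_lam|_].
  by have := n_ge _ _ rc_lam; lia.
by case E: T.[? (r, c)] => [v|]; [have := T_range _ _ E |]; lia.
Qed.

Lemma jdt_slid T nu lam C a b : increasing_tableau T ->
  straight_shape nu -> straight_shape lam -> domf T = nu `\` lam ->
  (forall c, c \in C -> maximal_box lam c) ->
  (forall x : domf T, a <= T x <= b) ->
  exists lo hi t, [/\
    [/\ lo < hi, strictly_increasing t & represents lo hi t T],
    represents lo hi (slid t C) (jdt a b C T),
    forall r c, (t r c <= lo) = (((r, c) : box) \in lam) &
    forall r c, ((r, c) : box) \in C -> t r c <= lo < next_value t r c].
Proof.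
move=> T_incr nu_str lam_str domT C_max ab_T.
pose lo := a - 1; pose hi := Num.max a (b + 1).
have lo_hi : lo < hi by rewrite /lo /hi; lia.
have T_range x v : T.[? x] = Some v -> lo < v < hi.
  by case: fndP => // xT [<-]; have := ab_T [` xT]; rewrite /lo /hi; lia.
have [t [t_incr tT t_lam]] :=
  incr_extension T_incr nu_str lam_str domT lo_hi T_range.
have C_corner r c : ((r, c) : box) \in C -> t r c <= lo < next_value t r c.
  move=> /C_max[rc_lam rc_max]; rewrite t_lam rc_lam /=.
  have above r' c' : (((r, c) : box) < (r', c'))%O -> lo < t r' c'.
    by move=> lt_rc; rewrite ltNge t_lam; apply/negP => /rc_max.
  by have [-> | ->] := next_valueP t r c; apply: above; rewrite box_ltE; lia.
exists lo, hi, t; split=> //; exact: jdt_represents.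
Qed.

(** * Row words of fillings *)

Lemma represents_row lo hi t T r N : represents lo hi t T ->
  pmap (fun a => T.[? a]) [seq ((r, c) : box) | c <- iota 0 N] =
  letters lo hi (t r) 0 N.
Proof.
move=> tT; rewrite /letters; elim: (iota 0 N) => //= c s ->.
by rewrite tT; case: ifP.
Qed.

Lemma reading_order_trans : transitive reading_order.
Proof. by move=> [a b] [c d] [e f]; rewrite /reading_order /=; lia. Qed.

Lemma reading_order_anti : antisymmetric reading_order.
Proof.
move=> [a b] [c d]; rewrite /reading_order /= => H.
by congr pair; lia.
Qed.

Lemma reading_order_total : total reading_order.
Proof. by move=> [a b] [c d]; rewrite /reading_order /=; lia. Qed.

Definition grid (m n : nat) : seq box :=
  [seq ((r, c) : box) | r <- rev (iota 0 m), c <- iota 0 n].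

Lemma mem_grid m n r c : (((r, c) : box) \in grid m n) = (r < m)%N && (c < n)%N.
Proof.
apply/allpairsP/andP => /= [[[r' c'] /= [+ + [-> ->]]]|[rm cn]].
  by rewrite mem_rev !mem_iota.
by exists (r, c); rewrite mem_rev !mem_iota.
Qed.

Lemma grid_sorted m n : sorted reading_order (grid m n).
Proof.
rewrite (sorted_pairwise reading_order_trans) /grid; elim: m => // m IH.
rewrite -addn1 iotaD rev_cat /= pairwise_cat {}IH andbT; apply/andP; split.
  apply/allrelP => [[r c] [r' c']] /mapP[x _ [-> _]].
  move=> /allpairsP[[y z] /= [+ _ [-> _]]].
  by rewrite mem_rev mem_iota /reading_order /=; lia.
rewrite pairwise_map; apply/(pairwiseP 0%N) => i j.
rewrite !inE size_iota => ii jj ij.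
by rewrite !nth_iota // /reading_order /=; lia.
Qed.

Lemma grid_uniq m n : uniq (grid m n).
Proof.
apply: allpairs_uniq; rewrite ?rev_uniq ?iota_uniq //.
by move=> [a b] [c d] _ _ [-> ->].
Qed.

(** A grid large enough to contain the shape is already in reading order, so filtering it by the
    shape gives the sorted domain. *)
Lemma row_wordE lo hi t T m n : represents lo hi t T ->
  strictly_increasing t -> (forall r, hi <= t r n) -> hi <= t m 0%N ->
  row_word T = rows_word lo hi n t 0 m.
Proof.
move=> tT t_incr t_wide t_tall; rewrite /row_word.
have -> : sort reading_order (domf T) = [seq b <- grid m n | b \in domf T].
  apply: (sorted_eq reading_order_trans reading_order_anti).
  - exact: sort_sorted reading_order_total _.
  - exact: sorted_filter reading_order_trans _ _ (grid_sorted m n).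
  rewrite perm_sort.
  apply: uniq_perm; rewrite ?fset_uniq ?filter_uniq ?grid_uniq //.
  move=> [r c]; rewrite mem_filter mem_grid andb_idr //.
  rewrite (represents_domf _ _ tT) => t_range.
  apply/andP; split; rewrite ltnNge; apply/negP => le_n.
    by have := incr_box t_incr le_n (leq0n c); lia.
  by have := incr_leq (fun e => proj1 (t_incr r e)) le_n; have := t_wide r; lia.
transitivity (pmap (fun a => T.[? a]) (grid m n)).
  elim: (grid m n) => //= b s <-; case: (boolP (b \in domf T)) => bT /=.
    by rewrite in_fnd.
  by rewrite not_fnd.
rewrite /grid /rows_word /rows_concat; elim: (rev _) => //= r s <-.
by rewrite pmap_cat (represents_row _ _ tT).
Qed.

(** * Rectification *)

Lemma hecke_permutation_eq T U :
  hecke_permutation T = hecke_permutation U <->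
  sort_word id (row_word T) = sort_word id (row_word U).
Proof.
rewrite /hecke_permutation -!hecke_wordE; split => [->//|E].
by apply: sigma_eq => p; rewrite E.
Qed.

Lemma forward_slide_hecke T T' : forward_slide T T' ->
  increasing_tableau T' /\ hecke_permutation T' = hecke_permutation T.
Proof.
case=> T_incr [nu [lam [C [a [b [[nu_str lam_str _ domT] C_max ab_T ->]]]]]].
have [lo [hi [t [[lo_hi t_incr tT] tT' _ C_corner]]]] :=
  jdt_slid T_incr nu_str lam_str domT C_max ab_T.
have t'_incr := slid_incr C t_incr.
split; first exact: represents_increasing lo_hi t'_incr tT'.
pose n := `|hi - t 0%N 0%N|%N.
have t_wide r : hi <= t r n.
  by have := incr_box t_incr (leq0n r) (leq0n n); lia.
have t_tall : hi <= t n 0%N.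
  by have := incr_box t_incr (leq0n n) (leqnn 0); lia.
have t'_ge r c : hi <= t r c -> hi <= slid t C r c.
  by move=> /le_trans; apply; apply: slid_ge.
apply/hecke_permutation_eq.
rewrite (row_wordE tT t_incr t_wide t_tall).
have t'_wide r := t'_ge _ _ (t_wide r).
rewrite (row_wordE tT' t'_incr t'_wide (t'_ge _ _ t_tall)).
have := slid_word t_incr C_corner t_wide id (n := n) (k := 0).
by rewrite add0n cats0 => ->.
Qed.

Lemma slides_hecke T U : clos_refl_trans _ forward_slide T U ->
  increasing_tableau T ->
  increasing_tableau U /\ hecke_permutation U = hecke_permutation T.
Proof.
elim=> {T U} [T U /forward_slide_hecke//|//|T U V _ IH1 _ IH2 T_incr].
by have [/IH2[V_incr ->] ->] := IH1 T_incr.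
Qed.

Lemma exists_maximal_box (lam : {fset box}) : lam != fset0 ->
  exists b, maximal_box lam b.
Proof.
case/fset0Pn => b0 b0_lam.
pose size_of (x : lam) := ((val x).1 + (val x).2)%N.
have [x _ x_max] := arg_maxnP (P := xpredT) size_of (i0 := [` b0_lam]) isT.
exists (val x); split; first exact: valP.
move=> [r' c'] b_lam; have := x_max [` b_lam] isT.
by rewrite /size_of /=; case: (\val x) => r c; rewrite box_ltE /=; lia.
Qed.

(** Induction on the size of the inner shape: a slide into one maximal box removes exactly that box
    from it. *)
Lemma rectification_exists T : increasing_tableau T ->
  exists U, rectifies_to T U.
Proof.
move=> T_incr; have [[nu [lam [nu_str lam_str lam_nu domT]]] _] := T_incr.
move En: #|` lam|%N => n.
elim: n => [|n IH] in T T_incr nu lam nu_str lam_str lam_nu domT En *.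
  exists T; split; first exact: rt_refl.
  by rewrite domT (cardfs0_eq En) fsetD0.
have [|x x_max] := @exists_maximal_box lam; first by rewrite -cardfs_eq0 En.
have [x_lam _] := x_max.
pose m := (\max_(b : domf T) `|T b|)%N.
have T_range (b : domf T) : - m%:Z <= T b <= m%:Z.
  by have := leq_bigmax (F := fun b : domf T => `|T b|%N) b; rewrite -/m; lia.
have C_max c : c \in [fset x] -> maximal_box lam c.
  by rewrite in_fset1 => /eqP ->.
pose T' := jdt (- m%:Z) m%:Z [fset x] T.
have slideTT' : forward_slide T T'.
  by split=> //; exists nu, lam, [fset x], (- m%:Z), m%:Z; split.
have [T'_incr _] := forward_slide_hecke slideTT'.
have [lo [hi [t [[lo_hi t_incr tT] tT' t_lam C_corner]]]] :=
  jdt_slid T_incr nu_str lam_str domT C_max T_range.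
have [nu' nu'_str nu'E] := sublevel_shape hi (slid_incr [fset x] t_incr).
have lam'E r c : (((r, c) : box) \in lam `\ x) = (slid t [fset x] r c <= lo).
  by rewrite (slid_le_lo t_incr C_corner) t_lam in_fsetD1 in_fset1 andbC.
have [|||||U [TU U_str]] := IH T' T'_incr nu' (lam `\ x).
- exact: nu'_str.
- move=> b b' bb'; rewrite !in_fsetD1 => /andP[b'x b'_lam].
  rewrite (lam_str _ _ bb' b'_lam) andbT; apply/eqP => bx.
  have := x_max.2 _ b'_lam; rewrite -bx => /negP.
  rewrite lt_neqAle bb' andbT negbK.
  by rewrite bx eq_sym (negPf b'x).
- by apply/fsubsetP => -[r c]; rewrite lam'E nu'E; lia.
- apply/fsetP => -[r c].
  by rewrite in_fsetD lam'E nu'E (represents_domf _ _ tT'); lia.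
- by have := cardfsD1 x lam; rewrite x_lam En => -[].
exists U; split=> //; apply: rt_trans TU; exact: rt_step.
Qed.

(** The sum of coordinates is injective on a chain, which gives the upper bound; the path down
    column 0 and then along row [r] attains it. *)
Lemma max_chainE r c : max_chain (r, c) = (r + c + 1)%N.
Proof.
apply/eqP; rewrite eqn_leq; apply/andP; split.
  apply/bigmax_leqP_seq => D; rewrite fpowersetE => /fsubsetP D_below.
  case/andP => /forallP D_tot _.
  rewrite -(size_iota 0 (r + c + 1)) -(size_map (fun b : box => b.1 + b.2)%N D).
  apply: uniq_leq_size.
    rewrite map_inj_in_uniq ?fset_uniq // => -[i j] [i' j'] ij ij' /= E.
    have /forallP/(_ [` ij']) := D_tot [` ij].
    by rewrite /= /Order.comparable !box_leE; move=> H; congr pair; lia.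
  move=> _ /mapP[[i j] /D_below + ->].
  by rewrite mem_below box_leE mem_iota /=; lia.
pose s : seq box := [seq ((i, 0%N) : box) | i <- iota 0 r] ++
                    [seq ((r, j) : box) | j <- iota 0 c.+1].
have s_in (b : box) : b \in s ->
    (b.2 == 0%N) && (b.1 < r)%N || (b.1 == r) && (b.2 <= c)%N.
  by rewrite mem_cat => /orP[] /mapP[j + ->] /=; rewrite mem_iota; lia.
have s_uniq : uniq s.
  rewrite cat_uniq; apply/and3P; split.
  - by rewrite map_inj_uniq ?iota_uniq // => i j [].
  - apply/hasPn => _ /mapP[j _ ->]; apply/mapP => -[i].
    by rewrite mem_iota => + [E _]; lia.
  by rewrite map_inj_uniq ?iota_uniq // => i j [].
have rc_s : ((r, c) : box) \in s.
  rewrite mem_cat; apply/orP; right; apply/mapP; exists c => //.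
  by rewrite mem_iota; lia.
have -> : (r + c + 1)%N = #|` [fset x in s]|.
  by rewrite card_fseq undup_id // size_cat !size_map !size_iota; lia.
have fsE b : (b \in [fset x in s]) = (b \in s) by rewrite in_fset.
apply: (leq_bigmax_seq (F := fun D : {fset box} => #|` D|)).
  rewrite fpowersetE; apply/fsubsetP => -[i j]; rewrite fsE => /s_in /= ij.
  by rewrite mem_below box_leE; lia.
rewrite fsE rc_s andbT.
apply/forallP => -[[i j] ij]; apply/forallP => -[[i' j'] ij'].
rewrite /= /Order.comparable !box_leE.
have := s_in (i, j); rewrite -fsE ij => /(_ isT) /=.
have := s_in (i', j'); rewrite -fsE ij' => /(_ isT) /=.
by lia.
Qed.

(** An increasing row that starts above [lo] loses only a final segment to the filter, so list
    positions are columns counted from [i]. *)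
Lemma onth_letters lo hi g i n c : (forall d, g d < g d.+1) -> lo < g i ->
  (c < n)%N -> onth (letters lo hi g i n) c =
    if g (i + c)%N < hi then Some (g (i + c)%N) else None.
Proof.
move=> g_incr; elim: n i c => // n IH i c lo_i cn; rewrite lettersS lo_i /=.
have gi := g_incr i; case: ltrP => gi_hi; last first.
  have -> : letters lo hi g i.+1 n = [::].
    apply/eqP; rewrite -[_ == _]negbK -has_filter; apply/hasPn => v.
    case/mapP => d; rewrite mem_iota => /andP[id _] ->.
    by have := incr_ltn g_incr id; lia.
  have := incr_addn g_incr i c.
  by case: c {cn} => [|c] /=; case: ltrP => //; lia.
case: c cn => [|c] cn /=; first by rewrite addn0 gi_hi.
by rewrite IH ?addSnnS //; lia.
Qed.

Lemma letters_prefix lo hi g n : (forall d, g d < g d.+1) -> lo < g 0%N ->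
  letters lo hi g 0 n = [seq g c | c <- iota 0 (size (letters lo hi g 0 n))].
Proof.
move=> g_incr lo_0; elim: n => // n IH; rewrite lettersSr add0n.
case: ifP => // gn; rewrite size_rcons -addn1 iotaD map_cat -IH cats1.
suff -> : size (letters lo hi g 0 n) = n by [].
rewrite /letters size_filter count_map -[RHS](size_iota 0 n).
apply/eqP; rewrite -all_count; apply/allP => c; rewrite mem_iota /= => cn.
have := incr_ltn g_incr (cn : (c < n)%N).
by have := incr_leq g_incr (leq0n c); lia.
Qed.

Lemma fnd_minimal_tableau lam r c : (minimal_tableau lam).[? (r, c)] =
  if ((r, c) : box) \in lam then Some (r + c + 1)%:Z else None.
Proof.
case: ifP => [rc|/negbT rc]; last by rewrite not_fnd.
by rewrite (in_fnd (rc : _ \in domf (minimal_tableau lam))) ffunE /= max_chainE.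
Qed.

Lemma minimal_tableau_increasing lam : straight_shape lam ->
  increasing_tableau (minimal_tableau lam).
Proof.
move=> lam_str; split.
  by exists lam, fset0; split; rewrite ?fsetD0.
move=> [[r c] rc] [[r' c'] rc'] /=; rewrite box_ltE => lt_rc.
have := in_fnd rc; have := in_fnd rc'; rewrite !fnd_minimal_tableau.
by case: ifP => // _; case: ifP => // _ [<-] [<-]; lia.
Qed.

Lemma straight_extension T : increasing_tableau T -> straight_shape (domf T) ->
  exists lo hi t, [/\ lo < hi, strictly_increasing t, represents lo hi t T &
    forall r c, lo < t r c].
Proof.
move=> T_incr T_str; pose m := (\max_(b : domf T) `|T b|%N)%N.
have T_range b v : T.[? b] = Some v -> - m%:Z - 1 < v < m%:Z + 1.
  case: fndP => // bT [<-].
  have := leq_bigmax (F := fun b : domf T => `|T b|%N) [` bT].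
  by rewrite -/m; lia.
have str0 : straight_shape fset0 by move=> a b _; rewrite in_fset0.
have lo_hi : - m%:Z - 1 < m%:Z + 1 by lia.
have domT : domf T = domf T `\` fset0 by rewrite fsetD0.
have [t [t_incr tT t_lo]] :=
  incr_extension T_incr T_str str0 domT lo_hi T_range.
exists (- m%:Z - 1), (m%:Z + 1), t; split=> // r c.
by rewrite ltNge t_lo in_fset0.
Qed.

Lemma minimal_tableau_unique lam U : straight_shape lam ->
  increasing_tableau U -> straight_shape (domf U) ->
  hecke_permutation U = hecke_permutation (minimal_tableau lam) ->
  U = minimal_tableau lam.
Proof.
move=> lam_str U_incr U_str /hecke_permutation_eq.
have [lo [hi [t [lo_hi t_incr tU t_lo]]]] := straight_extension U_incr U_str.
have [lo' [hi' [t' [lo_hi' t'_incr tM t'_lo]]]] :=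
  straight_extension (minimal_tableau_increasing lam_str) lam_str.
pose n := (`|hi - t 0%N 0%N| + `|hi' - t' 0%N 0%N|)%N.
have t_far r c : (n <= r)%N \/ (n <= c)%N -> hi <= t r c.
  by have := incr_box t_incr (leq0n r) (leq0n c); rewrite /n; lia.
have t'_far r c : (n <= r)%N \/ (n <= c)%N -> hi' <= t' r c.
  by have := incr_box t'_incr (leq0n r) (leq0n c); rewrite /n; lia.
rewrite (row_wordE (m := n) (n := n) tU t_incr); last 2 first.
- by move=> r; apply: t_far; right.
- by apply: t_far; left.
rewrite (row_wordE (m := n) (n := n) tM t'_incr); last 2 first.
- by move=> r; apply: t'_far; right.
- by apply: t'_far; left.
pose R r := letters lo hi (t r) 0 n.
pose len r := size (letters lo' hi' (t' r) 0 n).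
have ME r : letters lo' hi' (t' r) 0 n = run r.+1%:Z (len r).
  rewrite letters_prefix //; last by move=> c; have [] := t'_incr r c.
  apply/eq_in_map => c; rewrite mem_iota /= add0n => c_len.
  have : t' r c \in letters lo' hi' (t' r) 0 n.
    rewrite letters_prefix //; last by move=> d; have [] := t'_incr r d.
    by apply/mapP; exists c; rewrite ?mem_iota.
  case/lettersP => d [_ Ed t'_range]; have := fnd_minimal_tableau lam r c.
  by rewrite tM Ed t'_range; case: ifP => // _ [->]; lia.
have len_decr r : (len r.+1 <= len r)%N.
  rewrite /len !size_filter !count_map; apply: sub_count => c /=.
  by have [_] := t'_incr r c; have := t'_lo r c; lia.
have -> : rows_word lo' hi' n t' 0 n =
          rows_concat (fun r => run r.+1%:Z (len r)) 0 n.
  by congr flatten; apply: eq_map.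
rewrite -[rows_word _ _ _ _ _ _]/(rows_concat R 0 n) => E.
(* The corner entry is the least letter of [U], and its position is moved by the permutation of [U].
   The letters of the minimal tableau are positive, so its permutation fixes every position up to
   0. *)
have t_ge1 r c : t r c < hi -> 1 <= t 0%N 0%N.
  move=> t_hi; rewrite leNgt; apply/negP => t_le0.
  have t00 := incr_box t_incr (leq0n r) (leq0n c).
  have : t 0%N 0%N < sort_word id (rows_concat R 0 n) (t 0%N 0%N).
    apply: sort_word_min.
      apply/allP => _ /mem_rows_concat[i _ /lettersP[j [_ -> _]]] /=.
      by have := incr_box t_incr (leq0n i) (leq0n j); lia.
    apply/flatten_mapP; exists 0%N; first by rewrite mem_rev mem_iota /n; lia.
    by apply/lettersP; exists 0%N; rewrite t_lo /n; split; lia.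
  rewrite E (@sort_word_fix _ _ 0) ?ltxx //.
  exact: (rows_gt 0 n (minimal_row_gt len)).
have R_gt r : all (> r%:Z) (R r).
  apply/allP => _ /lettersP[c [_ -> /andP[_ /[dup] /t_ge1 t00 _]]] /=.
  by have := incr_box t_incr (leq0n r) (leq0n c); lia.
have R_sorted r : sorted <%O (R r).
  by apply: letters_sorted => c; have [] := t_incr r c.
have RM := rows_unique R_sorted R_gt len_decr E.
apply/fmapP => -[r c]; rewrite tU tM.
have [rn|nr] := ltnP r n; last first.
  have := t_far r c (or_introl nr); have := t'_far r c (or_introl nr).
  by do 2 case: ifP => //; lia.
have [cn|nc] := ltnP c n; last first.
  have := t_far r c (or_intror nc); have := t'_far r c (or_intror nc).
  by do 2 case: ifP => //; lia.
rewrite !t_lo !t'_lo /=.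
have tr_incr d := proj1 (t_incr r d); have t'r_incr d := proj1 (t'_incr r d).
have := onth_letters hi tr_incr (t_lo r 0%N) cn; rewrite add0n => <-.
have := onth_letters hi' t'r_incr (t'_lo r 0%N) cn; rewrite add0n => <-.
by rewrite ME -RM ?rn.
Qed.

Theorem theorem6p6 (lam : {fset box}) (hlam : straight_shape lam) :
  unique_rectification_target (minimal_tableau lam) /\
  (forall T : {fmap box -> int}, increasing_tableau T ->
     rectifies_to T (minimal_tableau lam) <->
     hecke_permutation T = hecke_permutation (minimal_tableau lam)).
Proof.
have M_incr := minimal_tableau_increasing hlam.
have unique T U : increasing_tableau T -> rectifies_to T U ->
    hecke_permutation T = hecke_permutation (minimal_tableau lam) ->
    U = minimal_tableau lam.
  move=> T_incr [TU U_str] E; have [U_incr EU] := slides_hecke TU T_incr.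
  by apply: minimal_tableau_unique => //; rewrite EU.
have hecke T : increasing_tableau T -> rectifies_to T (minimal_tableau lam) ->
    hecke_permutation T = hecke_permutation (minimal_tableau lam).
  by move=> T_incr [TM _]; have [_ ->] := slides_hecke TM T_incr.
split.
  split=> // T T_incr TM U TU.
  exact: unique T_incr TU (hecke T T_incr TM).
move=> T T_incr; split; first exact: hecke.
(* Any rectification has the Hecke permutation of [T], so it must be the minimal tableau. *)
move=> E; have [U TU] := rectification_exists T_incr.
by rewrite -(unique T U).
Qed.
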